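(* Let $E$ be a Banach space with a basis $(e_i)$. Then either $E$ contains a minimal block subspace or a continuously tight block subspace.
   Context: All Banach spaces are real and infinite-dimensional, and ''subspace'' means infinite-dimensional closed subspace. $\mathbb N=\{0,1,2,\ldots\}$; $[x_n\mid n\in A]$ denotes the closed linear span; ''basis'' means normalised Schauder basis; $X\sqsubseteq Y$ means that $X$ is isomorphic to a closed subspace of $Y$. A space is minimal if it embeds into each of its subspaces. Blocks: for the normalised basis $(e_n)$, a countable subfield $\mathbf F$ of $\mathbb R$ containing $\mathbb Q$ is fixed such that the norm of every finite $\mathbf F$-linear combination of $(e_n)$ lies in $\mathbf F$. A block is a norm-one finite $\mathbf F$-linear combination of $(e_n)$; its support is the set of indices with non-zero coefficient. $\mathbf D$ is the (countable) set of blocks. A block sequence (block basis) of $(e_n)$ is an infinite sequence of blocks with successive supports; a block subspace is the closed linear span of a block sequence. The set $bb(e_n)$ of block sequences of $(e_n)$ is a closed subset of $\mathbf D^{\mathbb N}$, where $\mathbf D$ is discrete, and is given the induced (Polish) topology. The same field $\mathbf F$ is used for blocks of block sequences. Block sequences $(x_n)$ are identified with the block subspaces $[x_n]$ they span. $[\mathbb N]$ is the space of infinite subsets of $\mathbb N$ with the topology inherited from $2^{\mathbb N}$; for $A\in[\mathbb N]$, $A_n$ denotes the $(n+1)$-st element of $A$ in its increasing enumeration. A basis $(e_n)$ is continuously tight if there is a continuous function $f:bb(e_n)\to[\mathbb N]$ such that for every block basis $X$ of $(e_n)$, setting $I_j=[f(X)_{2j},f(X)_{2j+1}]$ (integer intervals),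 there is no infinite $A\subseteq\mathbb N$ with $X\sqsubseteq[e_n\mid n\notin\bigcup_{i\in A}I_i]$. A block subspace $[x_n]$ is continuously tight if its block basis $(x_n)$ is. *)

(* Defs.v *)
From HB Require Import structures.
From mathcomp Require Import all_boot all_order all_algebra.
From mathcomp Require Import all_classical all_reals all_analysis.
Set Implicit Arguments.
Unset Strict Implicit.
Unset Printing Implicit Defensive.
Import Order.TTheory GRing.Theory Num.Theory.
Import numFieldNormedType.Exports.

Local Open Scope classical_set_scope.
Local Open Scope ring_scope.

Section Subspaces.
Context {R : realType} {V : normedModType R}.
Implicit Types (A X Y Z : set V) (T S : V -> V).

Definition linear_subspace X := submod_closed [in X].

Definition lin_span A : set V := smallest linear_subspace A.

Definition closed_span A : set V := closure (lin_span A).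

Definition finite_dimensional X := exists s : seq V, X = lin_span [set` s].

(* In the source all Banach spaces, hence all subspaces, are
   infinite-dimensional; here this is always requested separately. *)
Definition closed_subspace X := linear_subspace X /\ closed X.

Definition linear_on X T :=
  forall a : R, {in X &, forall u v, T (a *: u + v) = a *: T u + T v}.

(* Only the restrictions of T to X and of S to Y matter. *)
Definition isomorphic X Y := exists T S,
  [/\ linear_on X T, set_bij X Y T, {in X, cancel T S},
      {within X, continuous T} & {within Y, continuous S}].

Definition embeds X Y := exists Z,
  [/\ closed_subspace Z, Z `<=` Y & isomorphic X Z].

Definition minimal_space X := forall Y, closed_subspace Y ->
  ~ finite_dimensional Y -> Y `<=` X -> embeds X Y.

End Subspaces.

Section Blocks.
Context {R : realType} {V : normedModType R}.
Implicit Types (F : {pred R}) (e x : nat -> V) (a : nat -> R) (u : V).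

Definition schauder_basis e := forall v : V,
  exists! a, series (fun i => a i *: e i) @ \oo --> v.

Definition normalised e := forall i, `|e i| = 1.

(* A subfield of R contains the rationals since R has characteristic 0. *)
Definition block_field F e :=
  [/\ divring_closed F, countable [set` F] &
      forall n a, (forall i, a i \in F) -> `|\sum_(i < n) a i *: e i| \in F].

Definition finite_expansion e u a := exists2 n : nat,
  forall i, (n <= i)%N -> a i = 0 & u = \sum_(i < n) a i *: e i.

(* The expansion is unique when e is linearly independent, in particular when
   e is a basis, or a block sequence of a basis. *)
Definition support e u : set nat :=
  [set i | exists2 a, finite_expansion e u a & a i != 0].

Definition block F e : set V := [set u | `|u| = 1 /\
  exists2 a, forall i, a i \in F & finite_expansion e u a].

Definition block_sequence F e x := (forall k, block F e (x k)) /\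
  forall k i j, support e (x k) i -> support e (x k.+1) j -> (i < j)%N.

(* The countable set of blocks is a subset of the (uncountable) discrete space
   on V; the topology that it induces on block sequences is the same. *)
Definition bb F e : set (prod_topology (fun _ : nat => discrete_topology V)) :=
  [set x | block_sequence F e x].

End Blocks.

Definition infinite_subsets : set cantor_space :=
  [set A | infinite_set [set n | A n]].

(* The (n+1)-st element of A: the k in A with exactly n elements of A below. *)
Definition nth_element (A : cantor_space) (n : nat) : nat :=
  xget 0%N [set k | A k /\ count A (iota 0 k) = n].

Definition interval_of (A : cantor_space) (j : nat) : set nat :=
  [set m | (nth_element A j.*2 <= m <= nth_element A j.*2.+1)%N].

(* The types [bb F e] and [infinite_subsets] carry the subspace topologies. *)
Definition continuously_tight {R : realType} {V : normedModType R}
    (F : {pred R}) (e : nat -> V) :=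
  exists2 f : bb F e -> infinite_subsets, continuous f &
    forall x : bb F e, ~ exists2 A : set nat, infinite_set A &
      embeds (closed_span (range (val x : nat -> V)))
        (closed_span
           [set e n | n in ~` \bigcup_(i in A) interval_of (val (f x)) i]).

(* Main.v *)
Require Import Defs.
From HB Require Import structures.
From mathcomp Require Import all_boot all_order all_algebra.
From mathcomp Require Import all_classical all_reals all_analysis.
From mathcomp Require Import ring lra.
Import Order.TTheory GRing.Theory Num.Theory.
Import numFieldNormedType.Exports.

Local Open Scope classical_set_scope.
Local Open Scope ring_scope.

(* A game is played on a block sequence [x]. One player draws vectors from block
   sequences of [x] presented by the opponent, picks [y_0, y_1, ...] in the span
   of the vectors drawn, and sets bounds; the opponent answers [u_k] in a finite
   dimensional space that is enlarged, at each answer, by blocks of [x] beyond the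
   bound. The first player wins if [y] and [u] stop being [C]-equivalent.

   If the first player wins for all [C], the winning strategies yield intervals
   depending continuously on the sequence [Y] they are played against, each
   interval ending beyond the bounds that the strategies set on answers supported
   before it. An embedding of [Y] missing infinitely many intervals would tell
   the opponent how to answer forever, so [x] is continuously tight.

   Otherwise some [C] is such that the first player wins on no block sequence of
   some [x_0]. There are countably many positions, so a diagonal argument gives
   [x] below [x_0] on which the status of each position is the same as on all
   block sequences of [x], and on which a non-losing opponent stays so whatever is
   drawn far enough. One then finds a subsequence [l] of [x] that the opponent can
   copy in [x] beyond any prescribed bounds; drawing this copy in a second play,
   the opponent moves it into an arbitrary block subspace. So [l] embeds with
   constant [C^2] into all its block subspaces, and spans a minimal space. *)

(** Tightness must defeat embeddings of which nothing is known, while each interval may consult only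
    finitely many terms of [Y]. Since vectors over [F] are countable, whatever the opponent answers
    can be coded by an integer: the interval of index j takes care of the codes up to j, and the
    infinite set of intervals avoided by an embedding always contains an index beyond the code in
    use.

    An embedding may also use everything that lies before the first interval it avoids. The
    strategies are therefore needed from every starting space spanned by [e_0 .. e_(N-1)], whereas
    the minimality argument wants an opponent who starts from nothing. [acc_initial] bridges the two
    at the cost of a factor depending only on N and the basis constant, which is harmless because
    there a single constant is enough.

    Winning is an inductive predicate since the first player wins at a finite stage. A position that
    is not won then hands the opponent a good answer at each move, so no determinacy theorem has to
    be invoked. *)

(** * Choice, limits and lists *)

Lemma dependent_choice_in (T : Type) (P : T -> Prop) (S : T -> T -> Prop) x0 :
  P x0 -> (forall x, P x -> exists2 y, P y & S x y) ->
  exists2 f : nat -> T, f 0%N = x0 &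
    forall n, P (f n) /\ S (f n) (f n.+1).
Proof.
move=> Px0 step.
have step' (x : {x | P x}) : exists y : {x | P x}, S (sval x) (sval y).
  by case: x => x Px; have [y Py Sxy] := step x Px; exists (exist _ y Py).
have [g gP] := choice step'.
exists (fun n => sval (iter n g (exist _ x0 Px0))) => // n; split => /=.
  exact: svalP.
exact: gP.
Qed.

Lemma half_pow_small {R : realType} (B eps : R) : 0 < eps ->
  exists N, forall n, (N <= n)%N -> B / 2 ^+ n < eps.
Proof.
move=> eps0; exists (Num.truncn (B / eps)).+1 => n Nn.
rewrite ltr_pdivrMr ?exprn_gt0// -ltr_pdivrMl// mulrC.
apply: lt_le_trans (truncnS_gt _) _.
by rewrite -natrX ler_nat (leq_trans Nn)// ltnW// ltn_expl.
Qed.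

Lemma cvg_norm_le {R : realType} {V : normedModType R} (u : nat -> V) (l v : V)
    (B : R) N : u @ \oo --> l -> (forall n, (N <= n)%N -> `|u n - v| <= B) ->
  `|l - v| <= B.
Proof.
move=> ul uB.
have H : (fun n => `|u n - v|) @ \oo --> `|l - v|.
  by apply: cvg_norm; apply: cvgB => //; exact: cvg_cst.
rewrite -(cvg_lim _ H)//; apply: limr_le; first by apply/cvg_ex; exists `|l - v|.
by exists N => // n /=; exact: uB.
Qed.

Lemma geometric_cvg {R : realType} {V : completeNormedModType R} (u : nat -> V)
    (B : R) : (forall m k, (m <= k)%N -> `|u k - u m| <= B / 2 ^+ m) ->
  exists2 l, u @ \oo --> l & forall m, `|l - u m| <= B / 2 ^+ m.
Proof.
move=> uB.
have : cvgn u.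
  apply: cauchy_cvg; apply: cauchy_exP => eps eps0.
  have [N NP] := half_pow_small B _ eps0.
  exists (u N), N => // n /= Nn; rewrite -ball_normE /= distrC.
  by apply: le_lt_trans (NP _ (leqnn N)); exact: uB.
move=> /cvg_ex[l ul]; exists l => // m.
by apply: (cvg_norm_le _ _ _ _ m ul) => n; exact: uB.
Qed.

Lemma list_choice (T : eqType) (Q : T -> T -> Prop) (s : seq T) :
  (forall q, q \in s -> exists r, Q q r) ->
  exists s' : seq T, (forall q, q \in s -> exists2 r, r \in s' & Q q r) /\
             (forall r, r \in s' -> exists2 q, q \in s & Q q r).
Proof.
elim: s => [|q s IH] sQ; first by exists [::].
have [|s' [s'1 s'2]] := IH; first by move=> p ps; apply: sQ; rewrite inE ps orbT.
have [r qr] := sQ q (mem_head _ _).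
exists (r :: s'); split => p; rewrite inE => /orP[/eqP ->|].
- by exists r => //; exact: mem_head.
- by move=> /s'1[r' r's' pr']; exists r' => //; rewrite inE r's' orbT.
- by exists q => //; exact: mem_head.
- by move=> /s'2[q' q's q'p]; exists q' => //; rewrite inE q's orbT.
Qed.

(** Turns lists grown by dependent choice into one infinite sequence: entry [k] is read in the list
    of length [k + 1], the first one that has it. *)
Lemma rcons_limit (T : Type) (x0 : T) (s : nat -> seq T) :
  s 0%N = [::] -> (forall n, exists a, s n.+1 = rcons (s n) a) ->
  forall n, s n = mkseq (fun k => nth x0 (s k.+1) k) n.
Proof.
move=> s0 sS; elim=> [|n IH]; first by rewrite s0.
have [a sa] := sS n.
have sz : size (s n) = n by rewrite IH size_mkseq.
by rewrite mkseqS -IH {2}sa nth_rcons sz ltnn eqxx.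
Qed.

(** * Spans over a subring *)

Section Span.
Context {R : realType} {V : lmodType R} {K : {pred R}}.
Implicit Types (A B : set V) (u v : V).

(** Used with two rings of scalars: [F], for which spans of blocks stay inside the countable set
    [VF], and all of [R], for which it is [lin_span]. *)
Inductive kspan A : V -> Prop :=
| kspan0 : kspan A 0
| kspan_cons a u v : a \in K -> A u -> kspan A v -> kspan A (a *: u + v).

Hypothesis Kring : subring_closed K.

Lemma ring1 : 1 \in K. Proof. by case: Kring. Qed.

Lemma ringB : {in K &, forall a b, a - b \in K}. Proof. by case: Kring. Qed.

Lemma ringM : {in K &, forall a b, a * b \in K}. Proof. by case: Kring. Qed.

Lemma ring0 : 0 \in K. Proof. by rewrite -(subrr 1) ringB// ring1. Qed.

Lemma ringN : {in K, forall a, - a \in K}.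
Proof. by move=> a Ka; rewrite -sub0r ringB// ring0. Qed.

Lemma ringD : {in K &, forall a b, a + b \in K}.
Proof. by move=> a b Ka Kb; rewrite -(opprK b) ringB// ringN. Qed.

Lemma kspan_incl A v : A v -> kspan A v.
Proof.
by rewrite -[v]addr0 -{2}[v]scale1r => Av; apply: kspan_cons;
  [exact: ring1| rewrite addr0 in Av| exact: kspan0].
Qed.

Lemma kspanD A u v : kspan A u -> kspan A v -> kspan A (u + v).
Proof.
elim=> [|a x y Ka Ax _ IH] Av; first by rewrite add0r.
by rewrite -addrA; apply: kspan_cons => //; exact: IH.
Qed.

Lemma kspanZ A a v : a \in K -> kspan A v -> kspan A (a *: v).
Proof.
move=> Ka; elim=> [|c x y Kc Ax _ IH]; first by rewrite scaler0; exact: kspan0.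
by rewrite scalerDr scalerA; apply: kspan_cons => //; exact: ringM.
Qed.

Lemma kspanB A u v : kspan A u -> kspan A v -> kspan A (u - v).
Proof.
move=> Au Av; apply: kspanD => //; rewrite -scaleN1r; apply: kspanZ => //.
by rewrite ringN// ring1.
Qed.

Lemma kspan_sum A (I : Type) (r : seq I) (Q : pred I) (f : I -> V) :
  (forall i, Q i -> kspan A (f i)) -> kspan A (\sum_(i <- r | Q i) f i).
Proof.
move=> Af; elim/big_rec: _ => [|i v Qi Av]; first exact: kspan0.
by apply: kspanD => //; exact: Af.
Qed.

Lemma kspan_trans A B v : A `<=` kspan B -> kspan A v -> kspan B v.
Proof.
move=> AB; elim=> [|a x y Ka Ax _ IH]; first exact: kspan0.
by apply: kspanD => //; apply: kspanZ => //; exact: AB.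
Qed.

Lemma kspan_mono A B v : A `<=` B -> kspan A v -> kspan B v.
Proof. by move=> AB; apply: kspan_trans => u /AB; exact: kspan_incl. Qed.

Lemma kspan_setU A B v : kspan (A `|` B) v ->
  exists u w, [/\ kspan A u, kspan B w & v = u + w].
Proof.
elim=> [|a x y Ka ABx _ [u [w [Au Bw ->]]]].
  by exists 0, 0; split; [exact: kspan0| exact: kspan0|rewrite addr0].
case: ABx => ABx.
  exists (a *: x + u), w; split => //; last by rewrite addrA.
  exact: kspan_cons.
exists u, (a *: x + w); split => //; last by rewrite addrCA.
exact: kspan_cons.
Qed.

Lemma kspan_seqP (G : seq V) v : kspan [set` G] v <-> exists2 a : nat -> R,
  forall i, a i \in K & v = \sum_(i < size G) a i *: G`_i.
Proof.
split; last first.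
  move=> [a Ka ->]; apply: kspan_sum => i _; apply: kspanZ => //.
  by apply: kspan_incl; rewrite /= mem_nth.
elim=> [|c x y Kc /= Gx _ [a Ka ->]].
  exists (fun=> 0) => [_|]; first exact: ring0.
  by rewrite big1// => i _; rewrite scale0r.
(* [G] may have repetitions; the new coefficient goes to the first occurrence of [x]. *)
exists (fun i => if i == index x G then c + a i else a i) => [i|].
  by case: ifP => // _; exact: ringD.
have xG : (index x G < size G)%N by rewrite index_mem.
rewrite (bigD1 (Ordinal xG))//= [RHS](bigD1 (Ordinal xG))//= eqxx nth_index//.
rewrite scalerDl -addrA; congr (_ + (_ + _)).
by apply: eq_bigr => i; rewrite -val_eqE /= => /negbTE ->.
Qed.

Lemma kspan_rangeP (x : nat -> V) v : kspan (range x) v <->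
  exists n, exists2 a : nat -> R, forall i, a i \in K & v = \sum_(i < n) a i *: x i.
Proof.
split; last first.
  move=> [n [a Ka ->]]; apply: kspan_sum => i _; apply: kspanZ => //.
  by apply: kspan_incl; exists (i : nat).
elim=> [|c _ y Kc [k _ <-] _ [n [a Ka ->]]].
  by exists 0%N, (fun=> 0) => [_|]; [exact: ring0| rewrite big_ord0].
exists (maxn k.+1 n),
  (fun i => (if i == k then c else 0) + (if (i < n)%N then a i else 0)).
  by move=> i; apply: ringD; case: ifP => // _; exact: ring0.
under [RHS]eq_bigr do rewrite scalerDl.
rewrite big_split /=; congr (_ + _).
  have kn : (k < maxn k.+1 n)%N by rewrite leq_max leqnn.
  rewrite (bigD1 (Ordinal kn))//= eqxx big1 ?addr0// => i.
  by rewrite -val_eqE /= => /negbTE ->; rewrite scale0r.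
rewrite -(subnKC (leq_maxr k.+1 n)) big_split_ord /= [X in _ = _ + X]big1 ?addr0.
  by apply: eq_bigr => i _; rewrite ltn_ord.
by move=> i _; rewrite ltnNge leq_addr scale0r.
Qed.

Lemma kspan_range_fin (x : nat -> V) v : kspan (range x) v ->
  exists n, forall m, (n <= m)%N -> kspan [set` [seq x i | i <- iota 0 m]] v.
Proof.
move=> /kspan_rangeP[n [a Ka ->]]; exists n => m nm.
apply: kspan_sum => i _; apply: kspanZ => //; apply: kspan_incl => /=.
by apply/mapP; exists (i : nat) => //; rewrite mem_iota /= add0n (leq_trans _ nm).
Qed.

End Span.
Arguments kspan {R V} K A v.

Lemma subring_predT (R : pzRingType) : subring_closed (@predT R).
Proof. by []. Qed.

Lemma lin_spanE {R : realType} {V : normedModType R} (A : set V) :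
  lin_span A = kspan predT A.
Proof.
apply/seteqP; split => v.
  apply; split.
    split => [|a u w]; rewrite ?inE; first exact: kspan0.
    move=> Au Aw; apply: kspanD => //; exact: (kspanZ (subring_predT R)).
  by move=> u; exact: (kspan_incl (subring_predT R)).
move=> Av X [[X0 Xl] AX]; elim: Av => [|a u w _ Au _ Xw].
  by move: X0; rewrite inE.
have := Xl a u w; rewrite !inE; apply => //; exact: AX.
Qed.

Lemma span_norm_comb {R : realType} {E : normedModType R} (L : E -> E -> Prop)
    (y u : seq E) :
  L 0 0 -> (forall (a : R) p q p' q', L p q -> L p' q' -> L (a *: p + p') (a *: q + q')) ->
  (forall i, L y`_i u`_i) -> forall n (a : nat -> R),
  L (\sum_(i < n) a i *: y`_i) (\sum_(i < n) a i *: u`_i).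
Proof.
move=> L0 LD Lyu n a; elim: n => [|n IH]; first by rewrite !big_ord0.
by rewrite !big_ord_recr /= addrC [X in L _ X]addrC; exact: LD.
Qed.

(** * Closed spans, extension of linear maps, isomorphism *)

Section ClosedSpan.
Context {R : realType} {V : completeNormedModType R}.
Implicit Types (A X Y : set V).

Lemma linear_subspaceP X : linear_subspace X <->
  X 0 /\ forall (a : R) u v, X u -> X v -> X (a *: u + v).
Proof.
split=> [[X0 XL]|[X0 XL]].
  split=> [|a u v Xu Xv]; first by rewrite inE in X0.
  by have := XL a u v; rewrite !inE; apply.
by split=> [|a u v]; rewrite !inE//; exact: XL.
Qed.

Lemma closureP X v : closure X v <-> forall eps : R, 0 < eps ->
  exists2 u, X u & `|v - u| < eps.
Proof.
split=> [Xv eps eps0|H B /nbhs_ballP[eps /= eps0 vB]].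
  have [u [Xu]] := Xv _ (nbhsx_ballx v eps eps0).
  by rewrite -ball_normE /= => vu; exists u.
have [u Xu vu] := H eps eps0; exists u; split => //.
by apply: vB; rewrite -ball_normE.
Qed.

Lemma closed_span_subspace A : closed_subspace (closed_span A).
Proof.
split; last exact: closed_closure.
have pT := subring_predT R.
apply/linear_subspaceP; split.
  apply: subset_closure; rewrite lin_spanE; exact: kspan0.
move=> a u v; rewrite /closed_span lin_spanE => /closureP Au /closureP Av.
apply/closureP => eps eps0.
have e2 : 0 < eps / 2 / (`|a| + 1) by rewrite !divr_gt0// ltr_wpDl.
have [u' Au' uu'] := Au _ e2.
have [v' Av' vv'] := Av (eps / 2) ltac:(exact: divr_gt0).
exists (a *: u' + v'); first by apply: kspanD => //; exact: (kspanZ pT).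
rewrite opprD addrACA -scalerBr (splitr eps).
apply: le_lt_trans (ler_normD _ _) _; apply: ltr_leD; last exact: ltW.
rewrite normrZ; move: uu'; rewrite ltr_pdivlMr ?ltr_wpDl// mulrC.
by apply: le_lt_trans; rewrite ler_wpM2r// lerDl.
Qed.

Lemma closed_span_min A Y : closed_subspace Y -> A `<=` Y -> closed_span A `<=` Y.
Proof.
move=> [YL Yc] AY; rewrite /closed_span [X in _ `<=` X]((closure_id Y).1 Yc).
by apply: closure_subset; apply: smallest_sub.
Qed.

Lemma lipschitz_within X (T : V -> V) (K : R) :
  {in X &, forall u v, `|T u - T v| <= K * `|u - v|} -> {within X, continuous T}.
Proof.
move=> TK; apply/subspace_continuousP => x Xx; apply/cvgrPdist_lt => eps eps0.
have d0 : 0 < eps / (`|K| + 1) by rewrite divr_gt0// ltr_wpDl.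
apply/nbhs_ballP; exists (eps / (`|K| + 1)) => //= y.
rewrite -ball_normE /= => xy Xy.
apply: le_lt_trans (TK x y _ _) _; rewrite ?inE//.
move: xy; rewrite ltr_pdivlMr ?ltr_wpDl// mulrC; apply: le_lt_trans.
by rewrite ler_wpM2r// (le_trans (ler_norm K))// lerDl.
Qed.

Lemma bounded_on X (T : V -> V) : linear_subspace X -> linear_on X T ->
  {within X, continuous T} -> exists2 K : R, 0 < K & forall v, X v -> `|T v| <= K * `|v|.
Proof.
move=> /linear_subspaceP[X0 XL] TL /subspace_continuousP/(_ 0 X0)/cvgrPdist_lt.
move=> /(_ 1 ltr01)/nbhs_ballP[d /= d0 dP].
have T0 : T 0 = 0.
  have := TL 1 0 0; rewrite !inE scaler0 addr0 scale1r => /(_ X0 X0)/eqP.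
  by rewrite -subr_eq0 opprD addrA subrr sub0r oppr_eq0 => /eqP.
have XZ a v : X v -> X (a *: v) by move=> Xv; rewrite -[_ *: _]addr0; exact: XL.
have TZ a v : X v -> T (a *: v) = a *: T v.
  by move=> Xv; have := TL a v 0; rewrite !inE T0 !addr0; exact.
exists (2 / d) => [|v Xv]; first exact: divr_gt0.
have [->|v0] := eqVneq v 0; first by rewrite T0 !normr0 mulr0.
have nv0 : 0 < `|v| by rewrite normr_gt0.
pose c := d / (2 * `|v|).
have c0 : 0 < c by rewrite divr_gt0// mulr_gt0.
have := dP (c *: v); rewrite -ball_normE /= sub0r normrN normrZ gtr0_norm//.
have -> : c * `|v| = d / 2 by rewrite /c; field; rewrite gt_eqF.
have -> : d / 2 < d by rewrite ltr_pdivrMr// ltr_pMr// ltr1n.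
move=> /(_ isT (XZ c v Xv)); rewrite /from_subspace T0 sub0r normrN TZ// normrZ gtr0_norm//.
rewrite -ltr_pdivlMl// mulr1 => /ltW/le_trans; apply.
by rewrite le_eqVlt; apply/orP; left; apply/eqP; rewrite /c; field; rewrite !gt_eqF.
Qed.

(** The span of the pairs [(l k, c k)] in the product serves as the graph of the correspondence from
    [l k] to [c k]; no linear independence has to be known beforehand. *)
Lemma kspan_fst_snd (l c : nat -> V) (p : V * V) :
  kspan predT (range (fun k => (l k, c k))) p <->
  exists n (a : nat -> R), p.1 = \sum_(i < n) a i *: l i /\ p.2 = \sum_(i < n) a i *: c i.
Proof.
have E' n (a : nat -> R) : \sum_(i < n) a i *: ((l i, c i) : V * V) =
    (\sum_(i < n) a i *: l i, \sum_(i < n) a i *: c i).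
  elim: n => [|n IH]; first by rewrite !big_ord0.
  by rewrite !big_ord_recr /= IH.
split.
  by move=> /(kspan_rangeP (subring_predT R))[n [a _ ->]]; exists n, a; rewrite E'.
case: p => p q [n [a /= [-> ->]]]; rewrite -E'.
by apply/(kspan_rangeP (subring_predT R)); exists n, a.
Qed.

Section Extension.
Variables (l c : nat -> V) (K : R).
Hypothesis K0 : 0 <= K.

Let P (p : V * V) := kspan (@predT R) (range (fun k => (l k, c k))) p.
(** The closure of that graph. Keeping it a relation makes the roles of [l] and [c] symmetric. *)
Let G x z := forall eps : R, 0 < eps ->
  exists2 p : V * V, P p & `|x - p.1| < eps /\ `|z - p.2| < eps.

Let GL a x z x' z' : G x z -> G x' z' -> G (a *: x + x') (a *: z + z').
Proof.
move=> Gxz Gxz' eps eps0.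
have e2 : 0 < eps / 2 / (`|a| + 1) by rewrite !divr_gt0// ltr_wpDl.
have [p Pp [px pz]] := Gxz _ e2.
have [q Pq [qx qz]] := Gxz' (eps / 2) ltac:(exact: divr_gt0).
exists (a *: p + q).
  by apply: kspanD => //; exact: (kspanZ (subring_predT R)).
have est (u v u' v' : V) : `|u - v| < eps / 2 / (`|a| + 1) -> `|u' - v'| < eps / 2 ->
    `|a *: u + u' - (a *: v + v')| < eps.
  move=> uv uv'; rewrite opprD addrACA -scalerBr (splitr eps).
  apply: le_lt_trans (ler_normD _ _) _; apply: ltr_leD; last exact: ltW.
  rewrite normrZ; move: uv; rewrite ltr_pdivlMr ?ltr_wpDl// mulrC.
  by apply: le_lt_trans; rewrite ler_wpM2r// lerDl.
by split; exact: est.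
Qed.

Let G_span x z : G x z -> closed_span (range c) z.
Proof.
move=> Gxz; apply/closureP => eps /Gxz[p /kspan_fst_snd[n [a [_ pE]]] [_ zp]].
exists p.2 => //; rewrite lin_spanE pE; apply/(kspan_rangeP (subring_predT R)).
by exists n, a.
Qed.

Hypothesis lc : forall n (a : nat -> R),
  `|\sum_(i < n) a i *: c i| <= K * `|\sum_(i < n) a i *: l i|.

Let G_norm x z : G x z -> `|z| <= K * `|x|.
Proof.
move=> Gxz; apply/ler_addgt0Pr => eps eps0.
pose d := eps / (K + 1).
have K1 : 0 < K + 1 by rewrite ltr_wpDl.
have d0 : 0 < d by rewrite divr_gt0.
have [p /kspan_fst_snd[n [a [p1 p2]]] [xp zp]] := Gxz d d0.
have pK : `|p.2| <= K * `|p.1| by rewrite p1 p2.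
have z1 : `|z| <= `|z - p.2| + `|p.2| by rewrite -{1}(subrK p.2 z) ler_normD.
have x1 : `|p.1| <= `|x - p.1| + `|x|.
  by rewrite (distrC x) -{1}(subrK x p.1) ler_normD.
have dE : d * (K + 1) = eps by rewrite /d divfK// gt_eqF.
rewrite -dE; have Kx1 := ler_wpM2l K0 x1; have Kxp := ler_wpM2l K0 (ltW xp).
apply: le_trans z1 _; apply: le_trans (lerD (ltW zp) (le_trans pK Kx1)) _.
rewrite !mulrDr mulr1 (mulrC d K); move: Kxp; move: (K * `|x - p.1|) (K * d) => A B; lra.
Qed.

Let G_total x : closed_span (range l) x -> exists z, G x z.
Proof.
rewrite /closed_span lin_spanE => /closureP lx.
have /choice[p pP] (n : nat) : exists p, P p /\ `|x - p.1| < 1 / 2 ^+ n.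
  have [u /(kspan_rangeP (subring_predT R))[m [a _ ->]] xu] :=
    lx (1 / 2 ^+ n) ltac:(by rewrite divr_gt0// exprn_gt0).
  exists (\sum_(i < m) a i *: l i, \sum_(i < m) a i *: c i); split => //.
  by apply/kspan_fst_snd; exists m, a.
have pK m k : `|(p k).2 - (p m).2| <= K * `|(p k).1 - (p m).1|.
  have /kspan_fst_snd[n [a [/= -> ->]]] :
      P ((p k).1 - (p m).1, (p k).2 - (p m).2); last exact: lc.
  exact: (kspanB (subring_predT R) _ _ _ (pP k).1 (pP m).1).
have [|z _ zP] := @geometric_cvg R V (fun n => (p n).2) (2 * K).
  move=> m k mk; apply: le_trans (pK m k) _.
  rewrite [2 * K]mulrC -mulrA ler_wpM2l//.
  rewrite -(subrK x (p k).1) -addrA; apply: le_trans (ler_normD _ _) _.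
  have -> : 2 / 2 ^+ m = 1 / 2 ^+ m + 1 / 2 ^+ m :> R by rewrite -mulrDl.
  apply: lerD; last by apply: ltW; case: (pP m).
  rewrite distrC; apply: ltW; case: (pP k) => _ /lt_le_trans; apply.
  by rewrite ler_pM2l// lef_pV2 ?posrE ?exprn_gt0// ler_eXn2l// ltr1n.
exists z => eps eps0.
have [N NP] := half_pow_small (2 * K + 1) eps eps0.
have NN := NP N (leqnn N); exists (p N); first by case: (pP N).
have N2 : 0 < (2 ^+ N)^-1 :> R by rewrite invr_gt0 exprn_gt0.
split; first by apply: lt_trans NN; case: (pP N) => _ /lt_le_trans; apply;
  rewrite ler_pM2r// lerDr mulr_ge0.
by apply: le_lt_trans (zP N) _; apply: lt_trans NN; rewrite ltr_pM2r// ltrDl.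
Qed.

(** The last clause characterises [G], so that the relation obtained with [l] and [c] exchanged can
    be recognised as its inverse. *)
Lemma closed_span_extension : exists G : V -> V -> Prop,
  [/\ forall a x z x' z', G x z -> G x' z' -> G (a *: x + x') (a *: z + z'),
      forall x z, G x z -> closed_span (range c) z /\ `|z| <= K * `|x|,
      forall x, closed_span (range l) x -> exists z, G x z &
      forall x z, G x z <-> forall eps : R, 0 < eps -> exists2 p : V * V,
        kspan (@predT R) (range (fun k => (l k, c k))) p &
        `|x - p.1| < eps /\ `|z - p.2| < eps].
Proof.
exists G; split => //.
by move=> x z Gxz; split; [exact: G_span Gxz|exact: G_norm].
Qed.

End Extension.

Lemma equivalent_isomorphic (l c : nat -> V) (K : R) : 0 <= K ->
  (forall n (a : nat -> R),
    `|\sum_(i < n) a i *: l i| <= K * `|\sum_(i < n) a i *: c i| /\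
    `|\sum_(i < n) a i *: c i| <= K * `|\sum_(i < n) a i *: l i|) ->
  isomorphic (closed_span (range l)) (closed_span (range c)).
Proof.
move=> K0 lc.
have [G [GL Gb Gt GE]] := @closed_span_extension l c K K0 (fun n a => (lc n a).2).
have [H [HL Hb Ht HE]] := @closed_span_extension c l K K0 (fun n a => (lc n a).1).
have GH x z : G x z <-> H z x.
  split=> [/GE xz|/HE xz]; [apply/HE|apply/GE] => eps;
    move=> /xz[p /kspan_fst_snd[n [a [p1 p2]]] [xp zp]];
    by exists (p.2, p.1) => //; apply/kspan_fst_snd; exists n, a.
have Gu x z z' : G x z -> G x z' -> z = z'.
  move=> xz xz'; have := GL (-1) _ _ _ _ xz xz'.
  rewrite scaleN1r addNr scaleN1r => /Gb[_]; rewrite normr0 mulr0 normr_le0 addrC subr_eq0.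
  by move=> /eqP.
have Hu z x x' : H z x -> H z x' -> x = x'.
  move=> xz xz'; have := HL (-1) _ _ _ _ xz xz'.
  rewrite scaleN1r addNr scaleN1r => /Hb[_]; rewrite normr0 mulr0 normr_le0 addrC subr_eq0.
  by move=> /eqP.
pose T x := xget 0 [set z | G x z]; pose S z := xget 0 [set x | H z x].
have TP x : closed_span (range l) x -> G x (T x).
  by move=> /Gt[z xz]; exact: (xgetI 0 (xz : [set z | G x z] z)).
have SP z : closed_span (range c) z -> H z (S z).
  by move=> /Ht[x xz]; exact: (xgetI 0 (xz : [set x | H z x] x)).
have lin A : linear_subspace (closed_span A) by case: (closed_span_subspace A).
exists T, S; split.
- move=> a u v; rewrite !inE => lu lv.
  have luv : closed_span (range l) (a *: u + v).
    by have /linear_subspaceP[_] := lin (range l); apply.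
  by apply: (Gu (a *: u + v)); [exact: TP|apply: GL; exact: TP].
- split=> [x /TP/Gb[]//|x y|z /SP zz].
    rewrite !inE => /TP + /TP; move=> + + xy; rewrite xy => /GH xT /GH yT.
    exact: Hu xT yT.
  have [lS _] := Hb _ _ zz; exists (S z) => //.
  by apply: Gu (TP _ lS) _; apply/GH.
- move=> x; rewrite inE => /TP xT; have [cT _] := Gb _ _ xT.
  by apply: Hu (SP _ cT) _; apply/GH.
- apply: (lipschitz_within _ _ K) => u v; rewrite !inE => /TP uT /TP vT.
  have := GL (-1) _ _ _ _ vT uT; rewrite !scaleN1r => /Gb[_].
  by rewrite ![- _ + _]addrC.
- apply: (lipschitz_within _ _ K) => u v; rewrite !inE => /SP uT /SP vT.
  have := HL (-1) _ _ _ _ vT uT; rewrite !scaleN1r => /Hb[_].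
  by rewrite ![- _ + _]addrC.
Qed.

(** Induction on the number of functionals: if [g n] does not vanish on [Y], then [Y] is spanned by
    the kernel of [g n] in [Y] and one vector outside it. *)
Lemma finite_codim n (g : nat -> V -> R) Y :
  (forall i a u v, g i (a *: u + v) = a * g i u + g i v) -> linear_subspace Y ->
  (forall y, Y y -> (forall i, (i < n)%N -> g i y = 0) -> y = 0) ->
  finite_dimensional Y.
Proof.
move=> gL; have pT := subring_predT R.
elim: n Y => [|n IH] Y YL Y0.
  have /linear_subspaceP[Yz _] := YL.
  exists [::]; rewrite lin_spanE; apply/seteqP; split => v.
    by move=> /Y0 ->//; exact: kspan0.
  by elim => // a u w _ /=.
pose Z := [set y | Y y /\ g n y = 0].
have /linear_subspaceP[Yz Yl] := YL.
have g0 : g n 0 = 0 by have := gL n (-1) 0 0; rewrite scaler0 addr0 mulN1r addNr.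
have [||s sE] := IH Z.
- apply/linear_subspaceP; split=> [//|a u v [Yu gu] [Yv gv]].
  by split; [exact: Yl|rewrite gL gu gv mulr0 addr0].
- move=> y [Yy gy] yn; apply: Y0 => // i; rewrite ltnS leq_eqVlt.
  by move=> /orP[/eqP ->//|]; exact: yn.
have [[y [Yy gy]]|nY] := pselect (exists y, Y y /\ g n y != 0); last first.
  exists s; rewrite -sE; apply/seteqP; split=> [y Yy|y []//].
  by split => //; apply/eqP; apply: contrapT => /negP gy; apply: nY; exists y.
exists (y :: s); rewrite lin_spanE; apply/seteqP; split => v.
  move=> Yv; pose a := g n v / g n y.
  have Zv : Z (- a *: y + v).
    by split; [exact: Yl|rewrite gL /a mulNr divfK// addNr].
  rewrite -[v](addKr (- a *: y)) -scaleNr opprK; apply: kspan_cons => //=.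
    exact: mem_head.
  move: Zv; rewrite sE lin_spanE; apply: (kspan_mono pT) => w /= ws.
  by rewrite inE ws orbT.
elim => [//|a u w _ us _ Yw]; apply: Yl => //.
move: us; rewrite /= inE => /orP[/eqP ->//|us].
have : Z u by rewrite sE lin_spanE; exact: (kspan_incl pT).
by case.
Qed.

End ClosedSpan.

(** * Increasing enumerations and continuity on block sequences *)

Section Enumeration.
Variable g : nat -> nat.
Hypothesis g_incr : forall n, (g n < g n.+1)%N.

Definition range_set : cantor_space := fun k => `[< exists n, g n = k >].

Lemma nth_element_range n : nth_element range_set n = g n.
Proof.
have g_lt : {homo g : i j / (i < j)%N} by apply: homo_ltn => // m k p; exact: ltn_trans.
have g_le : {homo g : i j / (i <= j)%N}.
  by apply: homo_leq => // [m k p|k]; [exact: leq_trans|exact: ltnW].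
have g_inj i j : g i = g j -> i = j.
  by move=> gij; case: (ltngtP i j) => // /g_lt; rewrite gij ltnn.
have cnt k m : (forall i, (i < m)%N -> (g i < k)%N) -> (k <= g m)%N ->
    count range_set (iota 0 k) = m.
  elim: k m => [|k IH] m mk km.
    by case: m mk {km} => // m /(_ 0%N (ltn0Sn m)).
  rewrite -addn1 iotaD count_cat /= add0n addn0.
  have [[j gj]|nk] := pselect (exists j, g j = k).
    have -> : range_set k = true by apply/asboolP; exists j.
    have jm : m = j.+1.
      apply/eqP; rewrite eqn_leq; apply/andP; split; rewrite leqNgt; apply/negP.
        by move=> /mk; rewrite ltnS leqNgt -gj g_incr.
      rewrite ltnS => /g_le; rewrite gj => gmk.
      by move: km; rewrite ltnNge gmk.
    rewrite jm (IH j) ?addn1// ?gj// => i ij; rewrite -gj; exact: g_lt.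
  have -> : range_set k = false by apply/asboolP.
  rewrite addn0; apply: IH => [i im|]; last exact: ltnW.
  rewrite ltn_neqAle -ltnS mk// andbT; apply/eqP => gik.
  by apply: nk; exists i.
have cntg m : count range_set (iota 0 (g m)) = m.
  by apply: cnt => // i im; exact: g_lt.
apply: xget_unique; first by split; [apply/asboolP; exists n|exact: cntg].
by move=> k [/asboolP[m <-]]; rewrite cntg => ->.
Qed.

Lemma range_set_infinite : infinite_subsets range_set.
Proof.
rewrite /infinite_subsets /=.
have -> : [set n | range_set n] = range g.
  apply/seteqP; split => k /=; first by move=> /asboolP[n <-]; exists n.
  by move=> [n _ <-]; apply/asboolP; exists n.
move=> fin; apply: infinite_nat.
rewrite (_ : [set: nat] = g @^-1` range g); last first.
  by apply/seteqP; split => // n _; exists n.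
apply: finite_preimage fin => i j _ _ gij.
have g_lt : {homo g : i j / (i < j)%N} by apply: homo_ltn => // m k p; exact: ltn_trans.
by case: (ltngtP i j) => // /g_lt; rewrite gij ltnn.
Qed.

End Enumeration.

(** Both topologies are generated by coordinates. As the factors are discrete, agreeing with [x] up
    to [N] is a neighbourhood of [x], and convergence in Cantor space is tested one bit at a
    time. *)
Lemma locally_determined_continuous {V : choiceType}
    (B : set (prod_topology (fun _ : nat => discrete_topology V)))
    (D : set cantor_space) (f : B -> D) :
  (forall (x : B) n, exists N, forall y : B,
     (forall i, (i < N)%N -> val y i = val x i) -> val (f y) n = val (f x) n) ->
  continuous f.
Proof.
move=> fP x.
have near_prefix N : nbhs x [set y : B | forall i, (i < N)%N -> val y i = val x i].
  elim: N => [|N IH]; first by apply: filterS filterT.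
  have nN : nbhs x [set y : B | val y N = val x N].
    have : {for x, continuous (fun y : B => proj N (val y))}.
      apply: continuous_comp; first exact: initial_continuous.
      exact: proj_continuous.
    by move=> /(_ [set val x N]); apply; exact: discrete_set1.
  apply: filterS (filterI IH nN) => y [/= yi yN] i.
  by rewrite ltnS leq_eqVlt => /orP[/eqP ->|/yi].
suff fx : (fun y => val (f y)) @ x --> (val (f x) : cantor_space).
  move=> A [_ [/= [W Wo <-] Wfx WA]]; rewrite set_valE in Wfx WA.
  have fW : nbhs x (fun y => W (val (f y))) by exact: (fx W (open_nbhs_nbhs (conj Wo Wfx))).
  change (nbhs x (f @^-1` A)); apply: filterS fW => y; exact: WA.
apply/(@cvg_sup _ _ (fun i : nat =>
  Topological.class (initial_topology (fun h : nat -> bool => h i)))).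
  by apply: fmap_filter; exact: nbhs_filter.
move=> n A [_ [/= [W Wo <-] Wfx WA]]; change (nbhs x ((fun y => val (f y)) @^-1` A)).
have [N NP] := fP x n.
by apply: filterS (near_prefix N) => y /NP yx; apply: WA; rewrite /= yx.
Qed.

Section Dichotomy.
Context {R : realType} {E : completeNormedModType R} {F : {pred R}} {e : nat -> E}.
Hypothesis eb : schauder_basis e.
Hypothesis ef : block_field F e.
Hypothesis en : normalised e.

Local Notation fspan := (kspan F).

(** * The basis constant *)

Definition bcoef (v : E) : nat -> R := projT1 (cid (eb v)).

Definition bproj n (v : E) : E := \sum_(i < n) bcoef v i *: e i.

Lemma bcoefP v : series (fun i => bcoef v i *: e i) @ \oo --> v.
Proof. by rewrite /bcoef; case: cid => a []. Qed.

Lemma bcoef_unique v a : series (fun i => a i *: e i) @ \oo --> v -> bcoef v = a.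
Proof. by rewrite /bcoef; case: cid => b /= [_]; exact. Qed.

Lemma series_ord (u : nat -> E) n : series u n = \sum_(i < n) u i.
Proof. by rewrite /series /= big_mkord. Qed.

Lemma bproj_cvg v : bproj n v @[n --> \oo] --> v.
Proof.
rewrite (_ : (fun n => bproj n v) = series (fun i => bcoef v i *: e i)).
  exact: bcoefP.
by apply/funext => n; rewrite series_ord.
Qed.

Lemma bcoef_linear c u v i : bcoef (c *: u + v) i = c * bcoef u i + bcoef v i.
Proof.
suff -> : bcoef (c *: u + v) = fun i => c * bcoef u i + bcoef v i by [].
apply: bcoef_unique.
rewrite (_ : series _ = fun n => c *: bproj n u + bproj n v).
  by apply: cvgD; [apply: cvgZr; exact: bproj_cvg | exact: bproj_cvg].
apply/funext => n; rewrite series_ord /bproj scaler_sumr -big_split /=.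
by apply: eq_bigr => j _; rewrite scalerDl scalerA.
Qed.

Lemma bcoef0 i : bcoef 0 i = 0.
Proof.
have := bcoef_linear (-1) 0 0 i.
by rewrite scaler0 addr0 mulN1r addNr.
Qed.

Lemma bcoefZ c u i : bcoef (c *: u) i = c * bcoef u i.
Proof. by rewrite -[c *: u]addr0 bcoef_linear bcoef0 addr0. Qed.

Lemma bcoefD u v i : bcoef (u + v) i = bcoef u i + bcoef v i.
Proof. by rewrite -[u]scale1r bcoef_linear scale1r mul1r. Qed.

Lemma bcoefN u i : bcoef (- u) i = - bcoef u i.
Proof. by rewrite -scaleN1r bcoefZ mulN1r. Qed.

Lemma bcoefB u v i : bcoef (u - v) i = bcoef u i - bcoef v i.
Proof. by rewrite bcoefD bcoefN. Qed.

Lemma bcoef_sum (I : Type) (r : seq I) (Q : pred I) (f : I -> E) i :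
  bcoef (\sum_(j <- r | Q j) f j) i = \sum_(j <- r | Q j) bcoef (f j) i.
Proof.
elim/big_rec2: _ => [|j a b _ <-]; first exact: bcoef0.
by rewrite bcoefD.
Qed.

Lemma finite_series_cvg (a : nat -> R) m :
  (forall i, (m <= i)%N -> a i = 0) ->
  series (fun i => a i *: e i) @ \oo --> \sum_(i < m) a i *: e i.
Proof.
move=> a0; apply: cvg_near_cst; exists m => // n /= mn.
rewrite series_ord -(subnKC mn) big_split_ord /= [X in _ + X]big1 ?addr0//.
by move=> i _; rewrite a0 ?scale0r// leq_addr.
Qed.

Lemma bcoef_finite (a : nat -> R) m i : (forall i, (m <= i)%N -> a i = 0) ->
  bcoef (\sum_(i < m) a i *: e i) i = a i.
Proof. by move=> a0; rewrite (bcoef_unique _ a)//; exact: finite_series_cvg. Qed.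

Lemma bcoef_e i j : bcoef (e j) i = (i == j)%:R.
Proof.
have -> : e j = \sum_(i < j.+1) (i == j :> nat)%:R *: e i.
  rewrite big_ord_recr /= eqxx scale1r big1 ?add0r// => k _.
  by rewrite ltn_eqF ?scale0r.
rewrite (bcoef_finite (fun i => (i == j)%:R))// => k.
by move=> jk; rewrite gtn_eqF.
Qed.

Lemma eq_bcoef u v : (forall i, bcoef u i = bcoef v i) -> u = v.
Proof.
move=> uv.
have H : bproj n v @[n --> \oo] --> u.
  rewrite (_ : (fun n => bproj n v) = fun n => bproj n u); first exact: bproj_cvg.
  by apply/funext => n; apply: eq_bigr => i _; rewrite uv.
exact: (cvg_unique _ H (bproj_cvg v)).
Qed.

Lemma bprojD n u v : bproj n (u + v) = bproj n u + bproj n v.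
Proof.
by rewrite -big_split /=; apply: eq_bigr => i _; rewrite bcoefD scalerDl.
Qed.

Lemma bprojZ n c u : bproj n (c *: u) = c *: bproj n u.
Proof.
by rewrite scaler_sumr; apply: eq_bigr => i _; rewrite bcoefZ scalerA.
Qed.

Lemma bprojB n u v : bproj n (u - v) = bproj n u - bproj n v.
Proof. by rewrite bprojD -scaleN1r bprojZ scaleN1r. Qed.

Lemma bproj0 n : bproj n 0 = 0.
Proof. by rewrite /bproj big1// => i _; rewrite bcoef0 scale0r. Qed.

Lemma bproj_sum n (I : Type) (r : seq I) (Q : pred I) (f : I -> E) :
  bproj n (\sum_(j <- r | Q j) f j) = \sum_(j <- r | Q j) bproj n (f j).
Proof.
elim/big_rec2: _ => [|j a b _ <-]; first exact: bproj0.
by rewrite bprojD.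
Qed.

Lemma bcoef_proj n v i : bcoef (bproj n v) i = if (i < n)%N then bcoef v i else 0.
Proof.
rewrite /bproj.
transitivity (bcoef (\sum_(j < n) (if (j < n)%N then bcoef v j else 0) *: e j) i).
  by congr bcoef; apply: eq_bigr => j _; rewrite ltn_ord.
rewrite (bcoef_finite (fun i => if (i < n)%N then bcoef v i else 0))// => k nk.
by rewrite ltnNge nk.
Qed.

Lemma bproj_id n v : (forall i, (n <= i)%N -> bcoef v i = 0) -> bproj n v = v.
Proof.
move=> v0; apply: eq_bcoef => i; rewrite bcoef_proj.
by case: ltnP => // /v0 ->.
Qed.

Let sums_le (K : R) (v : E) := forall n, `|bproj n v| <= K.

Lemma bproj_pointwise_bounded v : exists2 K, 0 <= K & forall n, `|bproj n v| <= K.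
Proof.
have /cvg_seq_bounded [M [_ /(_ (M + 1))]] : cvgn (fun n => bproj n v).
  by apply/cvg_ex; exists v; exact: bproj_cvg.
rewrite ltrDl ltr01 => /(_ isT) H.
exists `|M + 1| => // n; apply: le_trans (ler_norm _).
exact: H.
Qed.

(** By Baire, the closure of some set of vectors with partial sums bounded by [m] contains a ball.
    Any [v], scaled to norm [r / 2], is a difference of two points of that ball, hence is
    approximated by differences of vectors with bounded partial sums. *)
Lemma bproj_open : exists K : R, [/\ 0 < K & forall v eps, 0 < eps ->
  exists2 w, forall n, `|bproj n w| <= K * `|v| & `|v - w| <= eps].
Proof.
pose A m := closure (sums_le m%:R).
have [m [x0 [r r0 xr]]] : exists m x0, exists2 r : R, 0 < r & ball x0 r `<=` A m.
  apply: contrapT => H.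
  have : forall m, open (~` A m) /\ dense (~` A m).
    move=> m; split; first by rewrite openC; exact: closed_closure.
    move=> O [x Ox] oO; apply: contrapT => /set0P/negP/negPn/eqP O0.
    apply: H; exists m, x.
    have /nbhs_ballP [r r0 xr] : nbhs x O by exact: open_nbhs_nbhs.
    exists r => // y /xr Oy; apply: contrapT => Ay.
    have : (O `&` ~` A m) y by [].
    by rewrite O0.
  move=> /Baire/(_ setT) [||x [_ Hx]]; [by exists 0|exact: openT|].
  have [K K0 xK] := bproj_pointwise_bounded x.
  apply: (Hx (Num.truncn K).+1 I); apply: subset_closure => n.
  apply: le_trans (xK n) _.
  by apply/ltW; rewrite truncnS_gt.
(* The bound [2 * m] divided by the scale [c] below; [m.+1] keeps the constant positive. *)
exists (4 * m.+1%:R / r); split => [|v eps eps0].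
  by rewrite divr_gt0 ?mulr_gt0.
have [->|v0] := eqVneq v 0.
  exists 0 => [n|]; first by rewrite bproj0 !normr0 mulr0.
  by rewrite subr0 normr0 ltW.
have nv0 : 0 < `|v| by rewrite normr_gt0.
pose c := r / (2 * `|v|).
have c0 : 0 < c by rewrite divr_gt0// mulr_gt0.
have pick y : ball x0 r y -> exists2 a, sums_le m%:R a & `|y - a| < eps * c / 2.
  move=> /xr /(_ (ball y (eps * c / 2))) [|a [Ba ya]].
    by apply: nbhsx_ballx; rewrite divr_gt0// mulr_gt0.
  by exists a => //; move: ya; rewrite -ball_normE.
have [a Ba xa] : exists2 a, sums_le m%:R a & `|x0 + c *: v - a| < eps * c / 2.
  apply: pick; rewrite -ball_normE /= opprD addrA subrr sub0r normrN normrZ.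
  have -> : `|c| * `|v| = r / 2 by rewrite gtr0_norm// /c; field; rewrite gt_eqF.
  by rewrite ltr_pdivrMr// ltr_pMr// ltr1n.
have [b Bb xb] : exists2 b, sums_le m%:R b & `|x0 - b| < eps * c / 2.
  by apply: pick; exact: ballxx.
exists (c^-1 *: (a - b)) => [n|].
  rewrite bprojZ normrZ gtr0_norm ?invr_gt0// bprojB.
  have -> : 4 * m.+1%:R / r * `|v| = c^-1 * (2 * m.+1%:R).
    rewrite /c; field.
    by rewrite !gt_eqF.
  rewrite ler_pM2l ?invr_gt0//; apply: le_trans (ler_normB _ _) _.
  rewrite mulr_natl mulr2n lerD//.
    by apply: le_trans (Ba n) _; rewrite ler_nat.
  by apply: le_trans (Bb n) _; rewrite ler_nat.
rewrite -[v in X in X <= _](@scalerK _ _ c) ?gt_eqF// -scalerBr normrZ.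
rewrite gtr0_norm ?invr_gt0// ler_pdivrMl//.
have -> : c *: v - (a - b) = (x0 + c *: v - a) - (x0 - b).
  by rewrite -(addrA x0) [x0 + (_ - a)]addrC addrKA opprK opprB addrA addrAC.
apply: le_trans (ler_normB _ _) _.
rewrite [c * _]mulrC (splitr (eps * c)); apply: ltW; exact: ltrD.
Qed.

Lemma norm_bcoef_e v i (B : R) : (forall n, `|bproj n v| <= B) ->
  `|bcoef v i| * `|e i| <= B + B.
Proof.
move=> vB; rewrite -normrZ.
have -> : bcoef v i *: e i = bproj i.+1 v - bproj i v.
  by rewrite /bproj big_ord_recr /= addrAC subrr add0r.
by apply: le_trans (ler_normB _ _) _; rewrite lerD.
Qed.

Lemma norm_e_gt0 i : 0 < `|e i|.
Proof.
rewrite normr_gt0; apply/eqP => e0.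
have := bcoef_e i i; rewrite e0 bcoef0 eqxx => /esym/eqP.
by rewrite oner_eq0.
Qed.

(* Open mapping argument: an approximation with bounded partial sums is
   corrected infinitely often, each time halving the error. *)
Lemma bproj_bounded : exists2 b : R, 1 <= b & forall n v, `|bproj n v| <= b * `|v|.
Proof.
have [K [K0 KP]] := bproj_open.
exists (2 * K + 1) => [|n v]; first by rewrite lerDr mulr_ge0 ?ltW.
suff H : `|bproj n v| <= 2 * K * `|v|.
  by apply: le_trans H _; rewrite ler_wpM2r// lerDl.
have [->|v0] := eqVneq v 0; first by rewrite bproj0 !normr0 mulr0.
have nv0 : 0 < `|v| by rewrite normr_gt0.
have /choice[g gP] (p : E * nat) : exists w,
    (forall n, `|bproj n w| <= K * `|p.1|) /\ `|p.1 - w| <= `|v| / 2 ^+ p.2.+1.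
  have [|w w1 w2] := KP p.1 (`|v| / 2 ^+ p.2.+1); last by exists w.
  by rewrite divr_gt0// exprn_gt0.
pose res := fix res k := if k is j.+1 then res j - g (res j, j) else v.
have resB k : `|res k| <= `|v| / 2 ^+ k.
  case: k => [|k]; first by rewrite expr0 divr1.
  by have [_] := gP (res k, k).
have resP k m : `|bproj m (g (res k, k))| <= K * `|v| / 2 ^+ k.
  have [/(_ m)/le_trans-> //] := gP (res k, k).
  by rewrite -mulrA ler_pM2l//=.
pose W k := v - res k.
have W0 : W 0 = 0 by rewrite /W subrr.
have WS k : W k.+1 = W k + g (res k, k) by rewrite /W /= opprB addrCA addrC.
have Wcauchy m i j : (i <= j)%N ->
    `|bproj m (W j - W i)| <= 2 * K * `|v| / 2 ^+ i.
  move=> /subnKC <-; move: (j - i)%N => {}j.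
  (* The negative term absorbs the increment at each step of the induction on [j]. *)
  suff : `|bproj m (W (i + j)%N - W i)| <=
      2 * K * `|v| / 2 ^+ i - 2 * K * `|v| / 2 ^+ (i + j).
    by move/le_trans; apply; rewrite gerBl divr_ge0// ?exprn_ge0// !mulr_ge0// ltW.
  elim: j => [|j IH]; first by rewrite addn0 !subrr bproj0 normr0.
  rewrite addnS WS addrAC bprojD; apply: le_trans (ler_normD _ _) _.
  apply: le_trans (lerD IH (resP _ _)) _.
  rewrite [X in _ <= _ - X](_ : _ = K * `|v| / 2 ^+ (i + j)); last first.
    by rewrite exprS; field; rewrite expf_neq0.
  by rewrite le_eqVlt; apply/orP; left; apply/eqP; field; rewrite !expf_neq0.
have /choice[c cP] (i : nat) : exists l : R, (fun k => bcoef (W k) i) @ \oo --> l.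
  have [|l lP _] := @geometric_cvg R R (fun k => bcoef (W k) i)
      ((4 * K * `|v|) / `|e i|); last by exists l.
  move=> m k mk; rewrite -bcoefB.
  have := @norm_bcoef_e (W k - W m) i _ (fun n => Wcauchy n _ _ mk).
  rewrite -ler_pdivlMr ?norm_e_gt0// => /le_trans-> //.
  by rewrite le_eqVlt; apply/orP; left; apply/eqP; field;
    rewrite expf_neq0// gt_eqF// norm_e_gt0.
have pc m : (fun k => bproj m (W k)) @ \oo --> \sum_(i < m) c i *: e i.
  rewrite /bproj; elim: m => [|m IH].
    rewrite big_ord0; under eq_fun do rewrite big_ord0; exact: cvg_cst.
  rewrite big_ord_recr /=; under eq_fun do rewrite big_ord_recr /=.
  by apply: cvgD => //; apply: cvgZl; exact: cP.
have pcB m i : `|\sum_(i < m) c i *: e i - bproj m (W i)| <= 2 * K * `|v| / 2 ^+ i.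
  apply: (cvg_norm_le _ _ _ _ i (pc m)) => k ik.
  by rewrite -bprojB; exact: Wcauchy.
(* The limits [c] of the coefficients of [W k] are the coefficients of [v], by uniqueness of the
   expansion. The interchange of limits rests on [Wcauchy] being uniform in [m]. *)
suff cE : bcoef v = c.
  have := pcB n 0; rewrite W0 bproj0 subr0 expr0 divr1 => /(le_trans _); apply.
  by rewrite /bproj cE.
apply: bcoef_unique; apply/cvgrPdist_lt => eps eps0.
have [N NP] := half_pow_small ((2 * K + 1) * `|v|) (eps / 2) ltac:(exact: divr_gt0).
have /cvgrPdist_lt/(_ (eps / 2) ltac:(exact: divr_gt0))[M _ MP] := bproj_cvg (W N).
exists M => // m /= Mm; rewrite series_ord.
have -> : v - \sum_(i < m) c i *: e i =
   (W N - bproj m (W N)) + (res N - (\sum_(i < m) c i *: e i - bproj m (W N))).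
  by rewrite /W opprB addrA [v - res N - _ + _]addrAC addrNK addrA addrNK.
rewrite (splitr eps); apply: le_lt_trans (ler_normD _ _) _.
apply: ltrD; first exact: MP.
apply: le_lt_trans (NP _ (leqnn N)); apply: le_trans (ler_normB _ _) _.
rewrite mulrDl mul1r mulrDl addrC; exact: lerD.
Qed.

(** * Finitely supported vectors *)

Lemma field_ring : subring_closed F.
Proof. by case: ef => /GRing.divring_closedBM. Qed.

Let Fr := field_ring.

Lemma fieldV : {in F, forall a, a^-1 \in F}.
Proof.
case: ef => -[F1 _ Fd] _ _ a Fa; rewrite -[_^-1]mul1r; exact: Fd.
Qed.

Lemma field_nat n : n%:R \in F.
Proof.
elim: n => [|n IH]; first exact: (ring0 Fr).
by rewrite -natr1; apply: (ringD Fr) => //; exact: (ring1 Fr).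
Qed.

Lemma field_dense (a eps : R) : 0 < eps -> exists2 q, q \in F & `|a - q| < eps.
Proof.
move=> eps0.
have /rat_in_itvoo[q] : a - eps < a + eps by rewrite ltrD2l gt0_cp.
rewrite in_itv /= => /andP[aq qa].
exists (ratr q); last by rewrite ltr_distlC aq qa.
rewrite /ratr; case: (numq q) (denq q) => [n|n] d.
  rewrite -[_%:~R]/(n%:R); case: d => d.
    by apply: (ringM Fr); [|apply: fieldV]; exact: field_nat.
  rewrite NegzE mulrNz; apply: (ringM Fr); [|apply: fieldV];
    by rewrite ?(ringN Fr)//; exact: field_nat.
rewrite NegzE mulrNz mulNr; apply: (ringN Fr); case: d => d.
    by apply: (ringM Fr); [|apply: fieldV]; exact: field_nat.
  rewrite NegzE mulrNz; apply: (ringM Fr); [|apply: fieldV];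
    by rewrite ?(ringN Fr)//; exact: field_nat.
Qed.

(** The vectors on which the game is played: they are countably many by [VF_code], and can be
    normalised without leaving the set because of [VF_norm]. *)
Definition VF (v : E) := (forall i, bcoef v i \in F) /\
  exists m, forall i, (m <= i)%N -> bcoef v i = 0.

Definition tail n (v : E) := VF v /\ forall i, (i < n)%N -> bcoef v i = 0.

Definition seg m n (v : E) := (forall i, bcoef v i \in F) /\
  forall i, ~~ (m <= i < n)%N -> bcoef v i = 0.

Lemma seg_VF m n v : seg m n v -> VF v.
Proof.
move=> [vF v0]; split => //; exists n => i ni; apply: v0.
by rewrite negb_and -!leqNgt ni orbT.
Qed.

Lemma seg_tail m n v : seg m n v -> tail m v.
Proof.
move=> sv; split; first exact: seg_VF sv.
by move=> i im; case: sv => _; apply; rewrite negb_and -ltnNge im.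
Qed.

Lemma tail_seg m v : tail m v -> exists n, forall k, (n <= k)%N -> seg m k v.
Proof.
move=> [[vF [n nv]] mv]; exists n => k nk; split=> // i.
rewrite negb_and -ltnNge -leqNgt => /orP[/mv//|ki]; apply: nv.
exact: leq_trans ki.
Qed.

Lemma tail_le m n v : (m <= n)%N -> tail n v -> tail m v.
Proof. by move=> mn [vF nv]; split => // i im; apply: nv; exact: leq_trans mn. Qed.

Lemma seg_le m n m' n' v : (m' <= m)%N -> (n <= n')%N -> seg m n v -> seg m' n' v.
Proof.
move=> mm nn [vF v0]; split => // i imn; apply: v0; apply: contra imn.
by move=> /andP[mi ni]; rewrite (leq_trans mm)//= (leq_trans ni).
Qed.

Lemma VF_tail0 v : VF v <-> tail 0 v.
Proof. by split => [|[]]. Qed.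

Lemma seg_comb m n a u v : a \in F -> seg m n u -> seg m n v ->
  seg m n (a *: u + v).
Proof.
move=> Fa [uF u0] [vF v0]; split => i; first by rewrite bcoef_linear (ringD Fr)// (ringM Fr).
by move=> imn; rewrite bcoef_linear u0// v0// mulr0 addr0.
Qed.

Lemma seg0 m n : seg m n 0.
Proof. by split => i; rewrite bcoef0// (ring0 Fr). Qed.

Lemma tail_comb n a u v : a \in F -> tail n u -> tail n v -> tail n (a *: u + v).
Proof.
move=> Fa /tail_seg[k ku] /tail_seg[l lv]; apply: (seg_tail n (maxn k l)).
by apply: seg_comb => //; [apply: ku|apply: lv]; rewrite leq_max leqnn ?orbT.
Qed.

Lemma seg_span m n A v : A `<=` seg m n -> fspan A v -> seg m n v.
Proof.
move=> AS; elim => [|a u w Fa Au _ IH]; first exact: seg0.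
by apply: seg_comb => //; exact: AS.
Qed.

Lemma tail_span n A v : A `<=` tail n -> fspan A v -> tail n v.
Proof.
move=> AS; elim => [|a u w Fa Au _ IH]; first exact: (seg_tail n n _ (seg0 n n)).
by apply: tail_comb => //; exact: AS.
Qed.

Lemma VF_span A v : A `<=` VF -> fspan A v -> VF v.
Proof.
by move=> AV Av; apply/VF_tail0; apply: tail_span Av => u /AV /VF_tail0.
Qed.

Lemma seg_e i : seg i i.+1 (e i).
Proof.
split => k; rewrite bcoef_e; first exact: field_nat.
by rewrite ltnS -eqn_leq eq_sym => /negbTE ->.
Qed.

Lemma VF_expand v : VF v -> exists n, v = \sum_(i < n) bcoef v i *: e i.
Proof. by move=> [vF [m v0]]; exists m; rewrite -[LHS](bproj_id m). Qed.

Lemma VF_norm v : VF v -> `|v| \in F.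
Proof. by move=> vV; have [n ->] := VF_expand v vV; case: ef => _ _; apply; case: vV. Qed.

Lemma seg_disjoint m n v : tail n v -> seg m n v -> v = 0.
Proof.
move=> [_ nv] [_ sv]; apply: (eq_bcoef) => i; rewrite bcoef0.
by case: (ltnP i n) => ni; [exact: nv|apply: sv; rewrite [(i < n)%N]ltnNge ni andbF].
Qed.

Lemma VF_code : exists dec : nat -> E, forall v, VF v -> exists k, dec k = v.
Proof.
have [_ /countable_injP[f fI] _] := ef.
pose g n := xget 0 [set r | r \in F /\ f r = n].
have gP r : r \in F -> exists n, g n = r.
  move=> Fr'; exists (f r); apply: xget_unique => //= s [Fs fs].
  by apply: fI; rewrite ?inE.
pose dec k := if unpickle k is Some s then \sum_(i < size s) g (nth 0%N s i) *: e i else 0.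
exists dec => v vV; have [n ->] := VF_expand v vV.
have [h hP] := choice (fun i => gP _ (vV.1 i)).
exists (pickle [seq h i | i <- iota 0 n]); rewrite /dec pickleK size_map size_iota.
apply: eq_bigr => i _; rewrite (nth_map 0%N) ?size_iota// nth_iota// add0n.
by rewrite hP.
Qed.

(** * Block sequences *)

(** Weak monotonicity lets [phi] be constant past the end of a finite list, as in [sorted_blist]. *)
Definition succ_blocks n (f : nat -> E) (phi : nat -> nat) :=
  {homo phi : i j / (i <= j)%N} /\
  forall i, (i < n)%N -> `|f i| = 1 /\ seg (phi i) (phi i.+1) (f i).

Lemma bproj_succ_blocks n f phi (d : nat -> R) k : succ_blocks n f phi ->
  (k <= n)%N -> bproj (phi k) (\sum_(j < n) d j *: f j) = \sum_(j < k) d j *: f j.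
Proof.
move=> fP kn; rewrite bproj_sum -(subnKC kn) big_split_ord /= [X in _ + X]big1 ?addr0.
  apply: eq_bigr => j _; rewrite bprojZ bproj_id// => i ki.
  have [_ [_ ->//]] := fP.2 j (leq_trans (ltn_ord j) kn).
  rewrite negb_and -!leqNgt; apply/orP; right; apply: leq_trans ki.
  by apply: fP.1.
move=> j _; rewrite bprojZ (_ : bproj _ _ = 0) ?scaler0//.
rewrite /bproj big1// => i _.
have jn : (k + j < n)%N by rewrite -[ltnRHS](subnKC kn) ltn_add2l.
have [_ [_ ->]] := fP.2 _ jn; first by rewrite scale0r.
rewrite negb_and -ltnNge; apply/orP; left; apply: leq_trans (ltn_ord i) _.
by apply: fP.1; exact: leq_addr.
Qed.

Lemma succ_blocks_coef (b : R) n f phi (d : nat -> R) j :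
  (forall n v, `|bproj n v| <= b * `|v|) -> succ_blocks n f phi -> (j < n)%N ->
  `|d j| <= 2 * b * `|\sum_(i < n) d i *: f i|.
Proof.
move=> bP fP jn; have [fj _] := fP.2 j jn.
have -> : `|d j| = `|d j *: f j| by rewrite normrZ fj mulr1.
have -> : d j *: f j =
    bproj (phi j.+1) (\sum_(i < n) d i *: f i) - bproj (phi j) (\sum_(i < n) d i *: f i).
  rewrite (bproj_succ_blocks _ _ _ _ _ fP)// (bproj_succ_blocks _ _ _ _ _ fP)//; last exact: ltnW.
  by rewrite big_ord_recr /= addrAC subrr add0r.
apply: le_trans (ler_normB _ _) _; rewrite -mulrA mulr_natl mulr2n.
by apply: lerD; exact: bP.
Qed.

Lemma geometric_sum_lt n : \sum_(i < n) (2 ^+ i.+1)^-1 <= 1 :> R.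
Proof.
suff -> : \sum_(i < n) (2 ^+ i.+1)^-1 = 1 - (2 ^+ n)^-1 :> R.
  by rewrite gerBl invr_ge0 exprn_ge0.
elim: n => [|n IH]; first by rewrite big_ord0 expr0 invr1 subrr.
by rewrite big_ord_recr /= IH exprS invfM; set x := (2 ^+ n)^-1; lra.
Qed.

(** Each coefficient is at most [2 * b] times the norm of the combination of the [f i], and the
    weights [1 / 2 ^+ i.+1] add up to at most 1. *)
Lemma succ_blocks_perturb (b : R) n f phi (d : nat -> R) (g : nat -> E) (del : R) :
  (forall n v, `|bproj n v| <= b * `|v|) -> 0 <= b -> 0 <= del -> succ_blocks n f phi ->
  (forall i, (i < n)%N -> `|g i| <= del / 2 ^+ i.+1) ->
  `|\sum_(i < n) d i *: g i| <= 2 * b * del * `|\sum_(i < n) d i *: f i|.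
Proof.
move=> bP b0 del0 fP gP; pose S := `|\sum_(i < n) d i *: f i|; rewrite -/S.
apply: le_trans (ler_norm_sum _ _ _) _.
apply: (@le_trans _ _ (\sum_(i < n) (2 * b * S * del) * (2 ^+ i.+1)^-1)).
  apply: ler_sum => i _; rewrite normrZ -mulrA; apply: ler_pM => //.
    exact: (succ_blocks_coef b n f phi).
  exact: gP.
rewrite -mulr_sumr [X in _ <= X]mulrAC -[X in _ <= X]mulr1.
by apply: ler_wpM2l; rewrite ?geometric_sum_lt// !mulr_ge0// normr_ge0.
Qed.

Definition bseq_at (x : nat -> E) (phi : nat -> nat) :=
  (forall k, (phi k < phi k.+1)%N) /\
  forall k, `|x k| = 1 /\ seg (phi k) (phi k.+1) (x k).

Definition bseq x := exists phi, bseq_at x phi.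

(** Supports are measured in [e] throughout and [x] enters only through its [F]-span, which makes
    the relation transitive at once; [block_sequence_sub] links it to block sequences of [x]. *)
Definition sub (z x : nat -> E) := bseq z /\ forall k, fspan (range x) (z k).

Definition almost_sub (z x : nat -> E) :=
  bseq z /\ exists N, forall k, (N <= k)%N -> fspan (range x) (z k).

Lemma incr_homo (phi : nat -> nat) : (forall k, (phi k < phi k.+1)%N) ->
  {homo phi : i j / (i <= j)%N}.
Proof. by move=> incr; apply: homo_leq => // [m n p|k]; [exact: leq_trans|exact: ltnW]. Qed.

Lemma incr_lt (phi : nat -> nat) : (forall k, (phi k < phi k.+1)%N) ->
  {homo phi : i j / (i < j)%N}.
Proof. by move=> incr; apply: homo_ltn => // m n p; exact: ltn_trans. Qed.

Lemma incr_ge (phi : nat -> nat) k : (forall k, (phi k < phi k.+1)%N) -> (k <= phi k)%N.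
Proof. by move=> incr; elim: k => // k IH; exact: leq_ltn_trans (incr k). Qed.

Lemma bseq_at_tail x phi k : bseq_at x phi -> tail (phi k) (x k).
Proof. by move=> [_ /(_ k)[_]]; exact: seg_tail. Qed.

Lemma bseq_tail x k : bseq x -> tail k (x k).
Proof.
move=> [phi xphi]; apply: tail_le (bseq_at_tail _ _ k xphi).
by apply: incr_ge; case: xphi.
Qed.

Lemma bseq_norm x k : bseq x -> `|x k| = 1.
Proof. by move=> [phi [_ /(_ k)[]]]. Qed.

Lemma bseq_VF x k : bseq x -> VF (x k).
Proof. by move=> /(bseq_tail _ k)[]. Qed.

Lemma bseq_span_VF x v : bseq x -> fspan (range x) v -> VF v.
Proof. by move=> xb; apply: VF_span => // _ [k _ <-]; exact: bseq_VF. Qed.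

Lemma bseq_at_succ x phi n : bseq_at x phi -> succ_blocks n x phi.
Proof. by move=> [incr xP]; split; [exact: incr_homo|]. Qed.

Lemma bseq_subseq x (psi : nat -> nat) : (forall k, (psi k < psi k.+1)%N) ->
  bseq x -> bseq (x \o psi).
Proof.
move=> psiP [phi [incr xP]]; exists (phi \o psi); split => k /=.
  exact: incr_lt.
have [-> xs] := xP (psi k); split => //; apply: seg_le xs => //.
exact: incr_homo (psiP k).
Qed.

Lemma sub_refl x : bseq x -> sub x x.
Proof. by move=> xb; split => // k; apply: (kspan_incl Fr); exists k. Qed.

Lemma sub_span z x v : sub z x -> fspan (range z) v -> fspan (range x) v.
Proof. by move=> [_ zx]; apply: (kspan_trans Fr) => _ [k _ <-]. Qed.

Lemma sub_trans y x z : sub x y -> sub y z -> sub x z.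
Proof. by move=> [xb xy] yz; split => // k; exact: sub_span yz _. Qed.

Lemma sub_almost z x : sub z x -> almost_sub z x.
Proof. by move=> [zb zx]; split => //; exists 0%N. Qed.

Lemma sub_subseq x (psi : nat -> nat) : (forall k, (psi k < psi k.+1)%N) ->
  bseq x -> sub (x \o psi) x.
Proof.
move=> psiP xb; split; first exact: bseq_subseq.
by move=> k; apply: (kspan_incl Fr); exists (psi k).
Qed.

Lemma sub_shift x n : bseq x -> sub (fun k => x (k + n)%N) x.
Proof. by move=> xb; apply: (sub_subseq x (fun k => k + n)%N). Qed.

(** The part of [v] carried by the blocks before [N] is supported below [phi N]; being a difference
    of two vectors that vanish there, it is 0. *)
Lemma bseq_at_span_tail x phi N v : bseq_at x phi -> fspan (range x) v ->
  tail (phi N) v -> fspan [set x k | k in [set k | (N <= k)%N]] v.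
Proof.
move=> xphi xv vt.
have xinc : range x `<=` [set x k | k in [set k | (k < N)%N]] `|`
                        [set x k | k in [set k | (N <= k)%N]].
  by move=> _ [k _ <-]; case: (ltnP k N) => kN; [left|right]; exists k.
have [u [w [uS wS vE]]] := kspan_setU _ _ _ (kspan_mono Fr _ _ _ xinc xv).
suff u0 : u = 0 by rewrite vE u0 add0r.
have wt : tail (phi N) w.
  apply: tail_span wS => // _ [k Nk <-]; apply: tail_le (bseq_at_tail _ _ k xphi).
  by apply: incr_homo => //; case: xphi.
apply: (seg_disjoint 0 (phi N)).
  rewrite (_ : u = -1 *: w + v); last by rewrite vE scaleN1r addrC addrK.
  by apply: tail_comb => //; apply: (ringN Fr); exact: (ring1 Fr).
apply: seg_span uS => // _ [k kN <-]; have [_] := xphi.2 k.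
by apply: seg_le => //; apply: incr_homo => //; case: xphi.
Qed.

Lemma kspan_from_fin (x : nat -> E) N v : fspan [set x k | k in [set k | (N <= k)%N]] v ->
  exists n, forall m, (n <= m)%N -> fspan [set` [seq x i | i <- index_iota N m]] v.
Proof.
elim=> [|a _ u Fa [k /= Nk <-] _ [n nP]]; first by exists 0%N => m _; exact: kspan0.
exists (maxn k.+1 n) => m; rewrite geq_max => /andP[km nm].
apply: kspan_cons => //; last exact: nP.
by apply/mapP; exists k => //; rewrite mem_index_iota Nk.
Qed.

Lemma bseq_at_span_list x phi N (G : seq E) : bseq_at x phi ->
  (forall g, g \in G -> fspan (range x) g /\ tail (phi N) g) ->
  exists n, forall g, g \in G -> fspan [set` [seq x i | i <- index_iota N n]] g.
Proof.
move=> xphi; elim: G => [|g G IH] GP; first by exists 0%N.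
have [|n nP] := IH; first by move=> h hG; apply: GP; rewrite inE hG orbT.
have [gx gt] := GP g (mem_head _ _).
have [m mP] := kspan_from_fin _ _ _ (bseq_at_span_tail _ _ _ _ xphi gx gt).
exists (maxn m n) => h; rewrite inE => /orP[/eqP ->|/nP].
  by apply: mP; rewrite leq_maxl.
apply: (kspan_mono Fr) => _ /= /mapP[i + ->]; rewrite !mem_index_iota => /andP[Ni i_n].
by apply/mapP; exists i => //; rewrite mem_index_iota Ni leq_max i_n orbT.
Qed.

Lemma almost_sub_span z x : almost_sub z x -> exists M, forall v,
  fspan (range z) v -> tail M v -> fspan (range x) v.
Proof.
move=> [[phi zphi] [N NP]]; exists (phi N) => v zv vt.
apply: (kspan_trans Fr) (bseq_at_span_tail _ _ _ _ zphi zv vt) => _ [k Nk <-].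
exact: NP.
Qed.

Lemma almost_sub_shift z x : almost_sub z x ->
  exists N, sub (fun k => z (k + N)%N) x.
Proof.
move=> [zb [N NP]]; exists N; split; first by case: (sub_shift _ N zb).
by move=> k; apply: NP; rewrite leq_addl.
Qed.

Lemma sub_almost_trans w z x : sub w z -> almost_sub z x -> almost_sub w x.
Proof.
move=> [wb wz] zx; split => //; have [M MP] := almost_sub_span _ _ zx.
by exists M => k Mk; apply: MP => //; apply: tail_le (bseq_tail _ k wb).
Qed.

(** Diagonal argument along a decreasing chain of block sequences. The diagonal lies in each of them
    up to finitely many blocks, which is why [P k] has to be inherited along [almost_sub]. *)
Lemma fusion (P : nat -> (nat -> E) -> Prop) x0 : bseq x0 ->
  (forall k x z, P k x -> almost_sub z x -> P k z) ->
  (forall k x, sub x x0 -> exists2 z, sub z x & P k z) ->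
  exists2 x, sub x x0 & forall k, P k x.
Proof.
move=> x0b Ph Pd.
pose Inv (s : nat * (nat -> E) * nat) := sub s.1.2 x0.
pose Step (s t : nat * (nat -> E) * nat) :=
  [/\ t.1.1 = s.1.1.+1, sub t.1.2 s.1.2, P s.1.1 t.1.2, (s.2 < t.2)%N &
     seg s.2 t.2 (t.1.2 s.2)].
have [||f f0 fP] := @dependent_choice_in _ Inv Step (0%N, x0, 0%N).
- exact: sub_refl.
- move=> [[k x] h]; rewrite /Inv /Step /= => xx0; have [z zx Pz] := Pd k x xx0.
  have [n nP] := tail_seg _ _ (bseq_tail _ h zx.1).
  exists (k.+1, z, maxn h.+1 n); first exact: (sub_trans x).
  by split => //=; [rewrite leq_max leqnn|apply: nP; rewrite leq_maxr].
have fk k : (f k).1.1 = k.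
  elim: k => [|k IH]; first by rewrite f0.
  by have [_ [-> _ _ _ _]] := fP k; rewrite IH.
have fsub i j : (i <= j)%N -> sub (f j).1.2 (f i).1.2.
  move=> /subnKC <-; move: (j - i)%N => {}j; elim: j => [|j IH].
    by rewrite addn0; apply: sub_refl; case: (fP i) => -[].
  by rewrite addnS; have [_ [_ H _ _ _]] := fP (i + j)%N; exact: (sub_trans (f (i + j)%N).1.2).
(* Block number [j] of a block sequence vanishes below [j], so evaluating the new sequence at the
   bound already reached gives a block beyond that bound. *)
pose w k := (f k.+1).1.2 (f k).2.
have wb : bseq w.
  exists (fun k => (f k).2); split => k; have [_ [_ H _ lt sg]] := fP k => //.
  by split => //; rewrite /w; have [Hb _] := H; exact: bseq_norm.
have ws k i : (k <= i)%N -> fspan (range (f k).1.2) (w i).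
  move=> ki; have [_] := fsub k i.+1 (leqW ki); exact.
exists w => [|k].
  by split => // k; have := ws 0%N k (leq0n k); rewrite f0.
have [_ [_ _ H _ _]] := fP k; rewrite fk in H; apply: Ph H _.
by split => //; exists k.+1; exact: ws.
Qed.

Lemma VFP v : VF v <-> exists2 a, forall i, a i \in F & finite_expansion e v a.
Proof.
split=> [vV|[a aF [n an vE]]].
  exists (bcoef v); first by case: vV.
  case: vV => _ [n nv]; exists n => //.
  by rewrite -[LHS](bproj_id n).
have vc i : bcoef v i = a i by rewrite vE bcoef_finite.
by split => [i|]; [rewrite vc|exists n => i ni; rewrite vc an].
Qed.

(** [block_sequence] compares neighbouring supports only. As no row is zero, cutting just after the
    last index of each row gives consecutive intervals. *)
Lemma successive_supports (a : nat -> nat -> R) :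
  (forall k, exists n, forall i, (n <= i)%N -> a k i = 0) ->
  (forall k, exists i, a k i != 0) ->
  (forall k i j, a k i != 0 -> a k.+1 j != 0 -> (i < j)%N) ->
  exists2 psi : nat -> nat, forall k, (psi k < psi k.+1)%N &
    forall k i, ~~ (psi k <= i < psi k.+1)%N -> a k i = 0.
Proof.
move=> afin anz asucc.
have /choice[u uP] (k : nat) : exists m,
    a k m != 0 /\ forall i, (m < i)%N -> a k i = 0.
  have [n nP] := afin k; have [i ai] := anz k.
  have ex : exists i, a k i != 0 by exists i.
  have ub j : a k j != 0 -> (j <= n)%N.
    by apply: contraR; rewrite -ltnNge => nj; rewrite nP// ltnW.
  case: (ex_maxnP ex ub) => m am mP; exists m; split => // j mj.
  by apply/eqP; apply: contraTT mj => /mP; rewrite -leqNgt.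
exists (fun k => if k is j.+1 then (u j).+1 else 0%N).
  by case=> // k; rewrite ltnS; apply: asucc (uP k).1 (uP k.+1).1.
move=> k i; rewrite negb_and -ltnNge -leqNgt => /orP[|]; last exact: (uP k).2.
case: k => // k; rewrite ltnS => ik; apply/eqP; apply: contraTT ik => ai.
by rewrite -ltnNge; apply: asucc ai; exact: (uP k).1.
Qed.

Lemma block_sequence_sub x z : bseq x -> block_sequence F x z -> sub z x.
Proof.
move=> [phi [incr xP]] [zb zs].
have /choice[a aP] (k : nat) : exists a : nat -> R,
    (forall i, a i \in F) /\ finite_expansion x (z k) a.
  by have [_ [a aF aE]] := zb k; exists a.
have afin k : exists n, forall i, (n <= i)%N -> a k i = 0.
  by have [_ [n nP _]] := aP k; exists n.
have [||psi psi_incr psiP] := successive_supports a afin.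
- move=> k; apply: contrapT => H; have [nz _] := zb k.
  have [_ [n _ zE]] := aP k; move: nz; rewrite zE big1 ?normr0.
    by move/esym/eqP; rewrite oner_eq0.
  move=> i _; suff -> : a k i = 0 by rewrite scale0r.
  by apply/eqP; apply: contrapT => /negP ai; apply: H; exists (i : nat).
- move=> k i j ai aj; apply: (zs k); first by exists (a k) => //; exact: (aP k).2.
  by exists (a k.+1) => //; exact: (aP k.+1).2.
split; last first.
  move=> k; have [aF [n _ ->]] := aP k.
  by apply/(kspan_rangeP Fr); exists n, (a k).
exists (phi \o psi); split => k /=.
  exact: incr_lt.
split; first by have [] := zb k.
have [aF [n _ ->]] := aP k.
apply: (seg_span _ _ [set x i | i in [set i | (psi k <= i < psi k.+1)%N]]).
  move=> _ [i /andP[ki ik] <-]; have [_] := xP i.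
  by apply: seg_le; exact: incr_homo.
elim/big_rec: _ => [|i v _ IH]; first exact: kspan0.
have [ai|ai] := boolP (psi k <= i < psi k.+1)%N.
  by apply: kspan_cons => //; exists (i : nat).
by rewrite psiP// scale0r add0r.
Qed.

Lemma bseq_block_sequence x : bseq x -> block_sequence F e x.
Proof.
move=> xb; split => [k|k i j].
  by split; [exact: bseq_norm|exact/VFP/bseq_VF].
have supp u l : Defs.support e u l -> bcoef u l != 0.
  by move=> [a [n an ->]]; rewrite bcoef_finite.
have [phi [incr xP]] := xb.
move=> /supp xi /supp xj.
have bound l n : bcoef (x l) n != 0 -> (phi l <= n < phi l.+1)%N.
  by apply: contraR => nl; have [_ [_ ->]] := xP l.
have /andP[_ ik] := bound _ _ xi; have /andP[kj _] := bound _ _ xj.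
exact: leq_trans kj.
Qed.

Lemma bseq_basis : bseq e.
Proof. by exists id; split => // k; split; [exact: en|exact: seg_e]. Qed.

(** * The game *)

(** Draws have to be successive so that errors made on single drawn vectors can be summed by
    [succ_blocks_perturb]. *)
Definition blist (G : seq E) := exists phi, succ_blocks (size G) (nth 0 G) phi.

Definition equivalent (C : R) (y u : seq E) := forall a : nat -> R,
  `|\sum_(i < size y) a i *: y`_i| <= C * `|\sum_(i < size y) a i *: u`_i| /\
  `|\sum_(i < size y) a i *: u`_i| <= C * `|\sum_(i < size y) a i *: y`_i|.

(* In the position [D y G u], blocks [D] were drawn from block sequences of [x]
   presented by the opponent, vectors [y] were picked in the span of [D], and the
   opponent answered [u] in the span of [G], where [G] grows with each answer by
   vectors beyond a bound [n] set together with the pick. The position is accepted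
   when one can force [y] and [u] to be inequivalent after finitely many moves. *)
Inductive acc (C : R) (x : nat -> E) : seq E -> seq E -> seq E -> seq E -> Prop :=
| acc_bad D y G u : ~ equivalent C y u -> acc C x D y G u
| acc_draw D y G u (S : set (seq E)) :
    (forall z, sub z x -> exists vs, [/\ forall v, v \in vs -> fspan (range z) v,
       blist (D ++ vs) & S vs]) ->
    (forall vs, S vs -> acc C x (D ++ vs) y G u) -> acc C x D y G u
| acc_pick D y G u w n : fspan [set` D] w ->
    (forall G' v, (forall g, g \in G' -> fspan (range x) g /\ tail n g) ->
       fspan [set` G ++ G'] v -> acc C x D (rcons y w) (G ++ G') (rcons u v)) ->
    acc C x D y G u.

(** A tail of any block sequence of [z] is a block sequence of [x], so the same draws remain
    possible; raising the bounds puts the opponent's vectors, taken in the span of [z], into the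
    span of [x]. *)
Lemma acc_almost_sub C x z D y G u : almost_sub z x ->
  acc C x D y G u -> acc C z D y G u.
Proof.
move=> zx; elim=> {D y G u} [D y G u|D y G u S drw _ IH|D y G u w n Dw _ IH].
- exact: acc_bad.
- apply: (acc_draw _ _ _ _ _ _ S) => // w wz.
  have [N wN] := almost_sub_shift _ _ (sub_almost_trans _ _ _ wz zx).
  have [vs [vsw Dvs Svs]] := drw _ wN; exists vs; split => // v /vsw.
  by apply: (kspan_mono Fr) => _ [k _ <-]; exists (k + N)%N.
- have [M MP] := almost_sub_span _ _ zx.
  apply: (acc_pick _ _ _ _ _ _ w (maxn n M)) => // G' v G'P Gv.
  apply: IH => // g /G'P [gz gt]; split.
    by apply: MP => //; apply: tail_le gt; rewrite leq_maxr.
  by apply: tail_le gt; rewrite leq_maxl.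
Qed.

(** * Trading the initial basis vectors for far blocks *)

(** [q] is [p] with [e i] replaced by [z i]. As [r] vanishes on the first [N] indices and on the
    window from [h] to [t] that will contain the [z i], the coefficients [al] can be read off from
    either vector. *)
Definition swap_rel N h t (z : nat -> E) (p q : E) := exists (al : nat -> R) r,
  [/\ p = \sum_(i < N) al i *: e i + r, q = \sum_(i < N) al i *: z i + r &
   forall i, (i < N)%N || (h <= i < t)%N -> bcoef r i = 0].

Lemma swap_rel0 N h t z : swap_rel N h t z 0 0.
Proof.
exists (fun=> 0), 0; split => [||i _]; last exact: bcoef0.
  by rewrite addr0 big1// => i _; rewrite scale0r.
by rewrite addr0 big1// => i _; rewrite scale0r.
Qed.

Lemma swap_relD N h t z (a : R) p q p' q' : swap_rel N h t z p q ->
  swap_rel N h t z p' q' -> swap_rel N h t z (a *: p + p') (a *: q + q').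
Proof.
have key (f : nat -> E) (al al' : nat -> R) r r' :
    a *: (\sum_(i < N) al i *: f i + r) + (\sum_(i < N) al' i *: f i + r') =
    \sum_(i < N) (a * al i + al' i) *: f i + (a *: r + r').
  rewrite scalerDr addrACA scaler_sumr -big_split /=; congr (_ + _).
  by apply: eq_bigr => i _; rewrite scalerA scalerDl.
move=> [al [r [-> -> r0]]] [al' [r' [-> -> r'0]]].
exists (fun i => a * al i + al' i), (a *: r + r');
split => [||i iP]; [exact: (key e al al')|exact: (key z al al')|].
by rewrite bcoef_linear r0// r'0// mulr0 addr0.
Qed.

(** The two vectors differ by [N] terms [al i *: (e i - z i)], with [e i - z i] of norm at most 2.
    Projecting [q] to the window and then to a single block bounds [al i] by [(2 * b) ^+ 2] times
    the norm of [q]; from [p] the bound is even better. *)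
Lemma swap_rel_norm (b : R) N h t z phi p q :
  1 <= b -> (forall n v, `|bproj n v| <= b * `|v|) ->
  (N <= h)%N -> succ_blocks N z phi -> (h <= phi 0%N)%N -> (phi N <= t)%N ->
  swap_rel N h t z p q ->
  `|p| <= (1 + 8 * b ^+ 2 * N%:R) * `|q| /\ `|q| <= (1 + 8 * b ^+ 2 * N%:R) * `|p|.
Proof.
move=> b1 bP Nh zP h0 Nt [al [r [pE qE r0]]].
have b0 : 0 <= b by apply: le_trans b1.
have zseg i : (i < N)%N -> seg h t (z i).
  move=> iN; have [_] := zP.2 i iN; apply: seg_le.
    by apply: leq_trans h0 _; exact: zP.1.
  by apply: leq_trans Nt; exact: zP.1.
have diff (B : R) : (forall i, (i < N)%N -> `|al i| <= B) ->
    `|\sum_(i < N) al i *: e i - \sum_(i < N) al i *: z i| <= 2 * B * N%:R.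
  move=> alB; rewrite -sumrB; apply: le_trans (ler_norm_sum _ _ _) _.
  rewrite (_ : _ * N%:R = \sum_(i < N) 2 * B); last first.
    by rewrite sumr_const card_ord mulr_natr.
  apply: ler_sum => i _; rewrite -scalerBr normrZ mulrC; apply: ler_pM => //.
    apply: le_trans (ler_normB _ _) _; rewrite en.
    by have [->] := zP.2 i (ltn_ord i).
  exact: alB.
split.
  pose w := \sum_(i < N) al i *: z i.
  have wE : w = bproj t q - bproj h q.
    have wseg i : ~~ (h <= i < t)%N -> bcoef w i = 0.
      move=> iht; rewrite bcoef_sum big1// => j _; rewrite bcoefZ.
      by have [_ ->] := zseg j (ltn_ord j); rewrite ?mulr0.
    apply: eq_bcoef => i; rewrite bcoefB !bcoef_proj qE bcoefD -/w.
    have [iht|iht] := boolP (h <= i < t)%N.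
      have /andP[hi it] := iht.
      by rewrite it ltnNge hi /= r0 ?iht ?orbT// addr0 subr0.
    rewrite wseg// add0r.
    case: ltnP => it; case: ltnP => ih; rewrite ?subrr//.
      by move: iht; rewrite it ih.
    have : (h <= t)%N by apply: leq_trans Nt; apply: leq_trans h0 _; exact: zP.1.
    by rewrite leqNgt (leq_ltn_trans it ih).
  have wn : `|w| <= 2 * b * `|q|.
    rewrite wE; apply: le_trans (ler_normB _ _) _; rewrite -mulrA mulr_natl mulr2n.
    by apply: lerD; exact: bP.
  have alB i : (i < N)%N -> `|al i| <= 4 * b ^+ 2 * `|q|.
    move=> iN; apply: le_trans (succ_blocks_coef b N z phi al i bP zP iN) _.
    rewrite (_ : 4 * b ^+ 2 * `|q| = 2 * b * (2 * b * `|q|)); last by ring.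
    by rewrite ler_wpM2l// mulr_ge0.
  have -> : p = q + (\sum_(i < N) al i *: e i - w).
    by rewrite qE pE -/w [RHS]addrC addrA addrNK.
  rewrite mulrDl mul1r; apply: le_trans (ler_normD _ _) _; rewrite lerD2l.
  apply: le_trans (diff _ alB) _.
  by rewrite le_eqVlt; apply/orP; left; apply/eqP; ring.
have alB i : (i < N)%N -> `|al i| <= 2 * b * `|p|.
  move=> iN; have -> : al i = bcoef p i.
    rewrite pE bcoefD r0 ?iN// addr0.
    rewrite (_ : \sum_(i < N) _ = \sum_(i < N) (if (i < N)%N then al i else 0) *: e i).
      rewrite (bcoef_finite (fun i => if (i < N)%N then al i else 0))// ?iN// => k.
      by rewrite ltnNge => ->.
    by apply: eq_bigr => j _; rewrite ltn_ord.
  have := norm_bcoef_e p i (b * `|p|) (fun n => bP n p).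
  rewrite en mulr1 => /le_trans; apply.
  by rewrite le_eqVlt; apply/orP; left; apply/eqP; ring.
have -> : q = p - (\sum_(i < N) al i *: e i - \sum_(i < N) al i *: z i).
  by rewrite qE pE opprB [RHS]addrC addrA addrNK.
rewrite mulrDl mul1r; apply: le_trans (ler_normB _ _) _; rewrite lerD2l.
apply: le_trans (diff _ alB) _.
rewrite (_ : 2 * (2 * b * `|p|) * N%:R = (4 * b) * (N%:R * `|p|)); last by ring.
rewrite (_ : 8 * b ^+ 2 * N%:R * `|p| = (8 * b ^+ 2) * (N%:R * `|p|)); last by ring.
apply: ler_wpM2r; first exact: mulr_ge0.
by nra.
Qed.

Lemma kspan_cat (A B : seq E) v : fspan [set` A ++ B] v ->
  exists p r, [/\ fspan [set` A] p, fspan [set` B] r & v = p + r].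
Proof.
rewrite (_ : [set` A ++ B] = [set` A] `|` [set` B]); first exact: kspan_setU.
apply/seteqP; split => w /=; rewrite mem_cat; first by move=> /orP.
by move=> [|] ->; rewrite ?orbT.
Qed.

Lemma kspan_subseq (A B : seq E) v : {subset A <= B} -> fspan [set` A] v ->
  fspan [set` B] v.
Proof. by move=> AB; apply: (kspan_mono Fr) => w /= /AB. Qed.

Lemma kspan_mapP (f : nat -> E) N v :
  fspan [set` [seq f i | i <- iota 0 N]] v <-> exists2 a : nat -> R,
  forall i, a i \in F & v = \sum_(i < N) a i *: f i.
Proof.
split => [/(kspan_seqP Fr)[a aF ->]|[a aF ->]].
  exists a => //; rewrite size_map size_iota; apply: eq_bigr => i _.
  by rewrite (nth_map 0%N) ?size_iota// nth_iota.
apply: kspan_sum => i _; apply: (kspanZ Fr) => //; apply: (kspan_incl Fr) => /=.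
by apply/mapP; exists (i : nat) => //; rewrite mem_iota /= add0n.
Qed.

Lemma swap_vector N h t (z : nat -> E) (B : seq E) v :
  (forall g, g \in B -> forall i, (i < N)%N || (h <= i < t)%N -> bcoef g i = 0) ->
  fspan [set` [seq e i | i <- iota 0 N] ++ B] v ->
  exists2 w, fspan [set` [seq z i | i <- iota 0 N] ++ B] w & swap_rel N h t z v w.
Proof.
move=> B0 /kspan_cat[p [r [/kspan_mapP[a aF ->] Br ->]]].
exists (\sum_(i < N) a i *: z i + r).
  apply: kspanD.
    apply: (kspan_subseq [seq z i | i <- iota 0 N]).
      by move=> g gz; rewrite mem_cat gz.
    by apply/kspan_mapP; exists a.
  by apply: kspan_subseq Br => g gB; rewrite mem_cat gB orbT.
exists a, r; split => // i iP.
elim: Br => [|c g s _ /= gB _ IH]; first exact: bcoef0.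
by rewrite bcoef_linear IH (B0 g gB i iP) mulr0 addr0.
Qed.

Section Trade.
Variables (N h t : nat) (z : nat -> E) (C K : R) (x : nat -> E).
Hypotheses (C0 : 0 <= C) (K0 : 0 <= K).
Hypothesis swap_norm : forall p q, swap_rel N h t z p q ->
  `|p| <= K * `|q| /\ `|q| <= K * `|p|.

Lemma equiv_swap (y u v : seq E) : (forall i, swap_rel N h t z v`_i u`_i) ->
  equivalent C y v -> equivalent (C * K) y u.
Proof.
move=> vu yv a; have [yv1 yv2] := yv a.
have [|vu1 vu2] := swap_norm (\sum_(i < size y) a i *: v`_i) (\sum_(i < size y) a i *: u`_i).
  apply: (span_norm_comb (swap_rel N h t z)) => //; first exact: swap_rel0.
  by move=> *; exact: swap_relD.
split; first by apply: le_trans yv1 _; rewrite -mulrA ler_wpM2l.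
by apply: le_trans vu2 _; rewrite mulrAC [X in _ <= X]mulrC ler_wpM2l.
Qed.

(** The first player follows the game with the [z i] while the opponent actually uses the [e i]:
    [swap_vector] translates each answer, and inequivalence for [C * K] becomes inequivalence for
    [C]. *)
Lemma acc_trade D y G u : acc (C * K) x D y G u ->
  forall Gr v, G = [seq z i | i <- iota 0 N] ++ Gr -> size u = size v ->
  (forall i, swap_rel N h t z v`_i u`_i) ->
  (forall g, g \in Gr -> forall i, (i < N)%N || (h <= i < t)%N -> bcoef g i = 0) ->
  acc C x D y ([seq e i | i <- iota 0 N] ++ Gr) v.
Proof.
elim=> {D y G u} [D y G u bad|D y G u S drw _ IH|D y G u w n Dw _ IH] Gr v GE suv vu Gr0.
- by apply: acc_bad => yv; apply: bad; exact: equiv_swap vu yv.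
- by apply: (acc_draw _ _ _ _ _ _ S) => // vs Svs; exact: IH.
(* The larger bound makes later vectors vanish on the first [N] indices and on the window. *)
- apply: (acc_pick _ _ _ _ _ _ w (maxn n (maxn N t))) => // G' g G'P Gg.
  have GG0 f : f \in Gr ++ G' -> forall i, (i < N)%N || (h <= i < t)%N -> bcoef f i = 0.
    rewrite mem_cat => /orP[/Gr0//|/G'P[_ [_ ft]] i iP]; apply: ft.
    by rewrite !leq_max; case/orP: iP => [->|/andP[_ ->]]; rewrite ?orbT.
  rewrite -catA in Gg *; have [f Gf gf] := swap_vector _ _ _ z _ _ GG0 Gg.
  apply: (IH G' f) => //; first 1 last.
  - by rewrite GE -catA.
  - by rewrite GE -catA.
  - by rewrite !size_rcons suv.
  - move=> i; rewrite !nth_rcons suv; case: ltnP => // _.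
    by case: eqP => // _; exact: swap_rel0.
  - move=> f' /G'P[f'x f't]; split => //.
    by apply: tail_le f't; rewrite leq_maxl.
Qed.

End Trade.

Lemma tail_seg_list m (G : seq E) : (forall g, g \in G -> tail m g) ->
  exists2 h, (m <= h)%N & forall g, g \in G -> seg m h g.
Proof.
elim: G => [|g G IH] GP; first by exists m.
have [|h mh hP] := IH; first by move=> f fG; apply: GP; rewrite inE fG orbT.
have [k kP] := tail_seg _ _ (GP g (mem_head _ _)).
exists (maxn k h) => [|f]; first by rewrite leq_max mh orbT.
rewrite inE => /orP[/eqP ->|/hP]; first by apply: kP; rewrite leq_maxl.
by apply: seg_le => //; rewrite leq_maxr.
Qed.

(* The vectors [e_0 .. e_(N-1)] are replaced by blocks of [x] supported beyond
   the first answer of the opponent. *)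
Lemma acc_initial (N : nat) : exists2 K : R, 0 <= K &
  forall (C : R) (x : nat -> E) (D : seq E), 0 <= C -> bseq x ->
  acc (C * K) x D [::] [::] [::] -> acc C x D [::] [seq e i | i <- iota 0 N] [::].
Proof.
have [b b1 bP] := bproj_bounded.
pose K := 1 + 8 * b ^+ 2 * N%:R.
have b0 : 0 <= b by rewrite (le_trans _ b1).
have K0 : 0 <= K by rewrite addr_ge0// !mulr_ge0.
exists K => // C x D0 C0 [phi xphi].
suff gen D y G u : acc (C * K) x D y G u -> y = [::] -> G = [::] -> u = [::] ->
    acc C x D [::] [seq e i | i <- iota 0 N] [::] by move=> /gen; exact.
elim=> {D0 D y G u} [D y G u bad|D y G u S drw _ IH|D y G u w n Dw Hacc IH] yE GE uE; subst.
- by exfalso; apply: bad => a; rewrite !big_ord0 normr0 mulr0.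
- by apply: (acc_draw _ _ _ _ _ _ S) => // vs Svs; exact: IH.
apply: (acc_pick _ _ _ _ _ _ w (maxn n N)) => // G' g G'P Gg.
have [|h mh hP] := tail_seg_list (maxn n N) G'; first by move=> f /G'P[].
have Nh : (N <= h)%N by rewrite (leq_trans _ mh)// leq_maxr.
(* The swap waits for the first answer, so that [h] can be taken beyond the supports in [G']; the
   window then misses [G']. *)
pose z i := x (h + i)%N; pose t := phi (h + N)%N.
have hphi k : (h <= phi (h + k))%N.
  by apply: (@leq_trans (h + k)); [exact: leq_addr|apply: incr_ge; case: xphi].
have G'0 f : f \in G' -> forall i, (i < N)%N || (h <= i < t)%N -> bcoef f i = 0.
  move=> /hP[_ f0] i iP; apply: f0; rewrite negb_and -ltnNge -leqNgt.
  by case/orP: iP => [iN|/andP[->]]; rewrite ?orbT// (leq_trans iN)// leq_maxr.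
have [f Gf gf] := swap_vector _ _ _ z _ _ G'0 Gg.
have zP : succ_blocks N z (fun i => phi (h + i)%N).
  split => [i j ij|i _]; last by rewrite addnS; exact: xphi.2.
  by apply: incr_homo; rewrite ?leq_add2l//; case: xphi.
apply: (acc_trade N h t z C K x C0 K0)
  (Hacc ([seq z i | i <- iota 0 N] ++ G') f _ Gf) _ _ _ _ _ _ => //.
- move=> p q; apply: (swap_rel_norm b _ _ _ _ _ _ _ b1 bP Nh zP) => //.
- move=> f'; rewrite mem_cat => /orP[/mapP[i _ ->]|f'G].
    split; first by apply: (kspan_incl Fr); exists (h + i)%N.
    apply: tail_le (bseq_at_tail _ _ _ xphi); apply: leq_trans (hphi i).
    by rewrite (leq_trans _ mh)// leq_maxl.
  have [f'x f't] := G'P f' f'G; split => //.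
  by apply: tail_le f't; rewrite leq_maxl.
- by move=> [|i] //=; rewrite !nth_nil; exact: swap_rel0.
Qed.

(** * Deciding all positions at once *)

Definition all_VF (s : seq E) := forall v, v \in s -> VF v.

Lemma all_VF_cat s t : all_VF s -> all_VF t -> all_VF (s ++ t).
Proof. by move=> sV tV v; rewrite mem_cat => /orP[/sV|/tV]. Qed.

Lemma all_VF_rcons s v : all_VF s -> VF v -> all_VF (rcons s v).
Proof. by move=> sV vV w; rewrite mem_rcons inE => /orP[/eqP ->|/sV]. Qed.

Lemma span_all_VF s v : all_VF s -> fspan [set` s] v -> VF v.
Proof. by move=> sV; apply: VF_span => w /= /sV. Qed.

Definition good_pos (p : seq E * seq E * seq E * seq E) :=
  [/\ all_VF p.1.1.1, all_VF p.1.1.2, all_VF p.1.2 & all_VF p.2].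

(* This rests on positions being countably many. *)
Lemma fusion_positions (P : seq E * seq E * seq E * seq E -> (nat -> E) -> Prop) x0 :
  bseq x0 ->
  (forall p x z, P p x -> almost_sub z x -> P p z) ->
  (forall p x, good_pos p -> sub x x0 -> exists2 z, sub z x & P p z) ->
  exists2 x, sub x x0 & forall p, good_pos p -> P p x.
Proof.
move=> x0b Ph Pd; have [dec decP] := VF_code.
have decs s : all_VF s -> exists c, [seq dec k | k <- c] = s.
  elim: s => [|v s IH] sV; first by exists [::].
  have [k kv] := decP _ (sV v (mem_head _ _)).
  have [|c cs] := IH; first by move=> w ws; apply: sV; rewrite inE ws orbT.
  by exists (k :: c); rewrite /= kv cs.
pose D (c : seq nat * seq nat * seq nat * seq nat) := let d := map dec in
  (d c.1.1.1, d c.1.1.2, d c.1.2, d c.2).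
pose Q k x := if unpickle k is Some c then good_pos (D c) -> P (D c) x else True.
have [||x xx0 xQ] := fusion Q x0 x0b.
- move=> k x z; rewrite /Q; case: unpickle => // c Px zx gc.
  exact: Ph (Px gc) zx.
- move=> k x xx0; rewrite /Q; case: unpickle => [c|]; last first.
    by exists x => //; apply: sub_refl; case: xx0.
  have [gc|ngc] := pselect (good_pos (D c)).
    by have [z zx Pz] := Pd _ _ gc xx0; exists z.
  by exists x => //; apply: sub_refl; case: xx0.
exists x => // -[[[d y] g] u] gp; have [dV yV gV uV] := gp.
have [[cd dE] [cy yE]] := (decs _ dV, decs _ yV).
have [[cg gE] [cu uE]] := (decs _ gV, decs _ uV).
have := xQ (pickle (cd, cy, cg, cu)); rewrite /Q pickleK /D /=.
by rewrite dE yE gE uE; exact.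
Qed.

(** A first fusion gives [x1] deciding every position: it is accepted on [x1] or on no block
    sequence of [x1]. [tau] is the second case. If all answers to a pick left [tau], they would be
    accepted on [x1], and then so would the position before the pick. A second fusion gives the
    clause on draws. *)
Lemma opponent_strategy (C : R) x0 : bseq x0 ->
  (forall x, sub x x0 -> ~ acc C x [::] [::] [::] [::]) ->
  exists x (tau : seq E -> seq E -> seq E -> seq E -> Prop),
  [/\ sub x x0 /\ tau [::] [::] [::] [::],
   forall D y G u, tau D y G u -> equivalent C y u,
   forall D y G u w z n, tau D y G u -> fspan [set` D] w -> sub z x ->
     exists G' v, [/\ forall g, g \in G' -> fspan (range z) g /\ tail n g,
       fspan [set` G ++ G'] v & tau D (rcons y w) (G ++ G') (rcons u v)] &
   forall D y G u, tau D y G u -> exists N, forall vs,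
     (forall v, v \in vs -> fspan (range x) v /\ tail N v) ->
     blist (D ++ vs) -> tau (D ++ vs) y G u].
Proof.
move=> x0b rej.
pose P (p : seq E * seq E * seq E * seq E) x := acc C x p.1.1.1 p.1.1.2 p.1.2 p.2 \/
  forall z, sub z x -> ~ acc C z p.1.1.1 p.1.1.2 p.1.2 p.2.
have [||x1 x1x0 x1P] := fusion_positions P x0 x0b.
- move=> p x z [a|r] zx; [left|right]; first exact: acc_almost_sub a.
  move=> w wz aw; have [n nx] := almost_sub_shift _ _ (sub_almost_trans _ _ _ wz zx).
  apply: r nx _; apply: acc_almost_sub aw; apply: sub_almost.
  by apply: sub_shift; case: wz.
- move=> p x _ xx0.
  have [[z zx az]|nz] := pselect (exists2 z, sub z x & acc C z p.1.1.1 p.1.1.2 p.1.2 p.2).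
    by exists z => //; left.
  exists x; first by apply: sub_refl; case: xx0.
  by right => z zx az; apply: nz; exists z.
pose tau D y G u := good_pos (D, y, G, u) /\ forall z, sub z x1 -> ~ acc C z D y G u.
have stable D y G u : good_pos (D, y, G, u) -> ~ tau D y G u -> acc C x1 D y G u.
  by move=> gp nt; have [//|r] := x1P _ gp; exfalso; apply: nt.
have x1b : bseq x1 by case: x1x0.
pose Q (p : seq E * seq E * seq E * seq E) (x : nat -> E) := tau p.1.1.1 p.1.1.2 p.1.2 p.2 ->
  exists N, forall vs, (forall v, v \in vs -> fspan (range x) v /\ tail N v) ->
     blist (p.1.1.1 ++ vs) -> tau (p.1.1.1 ++ vs) p.1.1.2 p.1.2 p.2.
have [||x2 x2x1 x2Q] := fusion_positions Q x1 x1b.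
- move=> p x z xQ zx /xQ[N NP]; have [M MP] := almost_sub_span _ _ zx.
  exists (maxn N M) => vs vsP; apply: NP => v /vsP[vz vt]; split.
    by apply: MP => //; apply: tail_le vt; rewrite leq_maxr.
  by apply: tail_le vt; rewrite leq_maxl.
- move=> [[[D y] G] u] x gp xx1; rewrite /Q /=.
  have [t|nt] := pselect (tau D y G u); last first.
    by exists x => //; apply: sub_refl; case: xx1.
  have nacc : ~ acc C x D y G u by apply: t.2.
  (* Otherwise every block sequence offers a draw leading to an accepted position, and [acc_draw]
     accepts the present one. *)
  have [z zx zP] : exists2 z, sub z x & forall vs,
      (forall v, v \in vs -> fspan (range z) v) -> blist (D ++ vs) ->
      ~ acc C x (D ++ vs) y G u.
    apply: contrapT => H; apply: nacc.
    apply: (acc_draw _ _ _ _ _ _ [set vs | acc C x (D ++ vs) y G u]) => // z zx.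
    apply: contrapT => H'; apply: H; exists z => // vs vsz Dvs a.
    by apply: H'; exists vs.
  (* On [z] itself all draws are safe; a positive bound arises only on passing to an
     [almost_sub]. *)
  exists z => // _; exists 0%N => vs vsP Dvs; apply: contrapT => nt.
  apply: (zP vs) => //; first by move=> v /vsP[].
  apply: acc_almost_sub (sub_almost _ _ xx1) _.
  have [[DV yV GV uV] _] := t.
  apply: stable nt; split => //=; apply: all_VF_cat => // v /vsP[zv _].
  by apply: bseq_span_VF zv; case: zx.
have zx1 z : sub z x2 -> sub z x1 by move=> zx2; exact: (sub_trans _ _ _ zx2 x2x1).
exists x2, tau; split.
- split; first exact: (sub_trans _ _ _ x2x1 x1x0).
  by split=> [|z zx]; [|apply: rej; exact: sub_trans zx x1x0].
- move=> D y G u [_ /(_ x1 (sub_refl _ x1b))] na; apply: contrapT => ne.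
  by apply: na; exact: acc_bad.
- move=> D y G u w z n [[DV yV GV uV] t] Dw zx2.
  apply: contrapT => H; apply: (t z (zx1 z zx2)).
  apply: (acc_pick _ _ _ _ _ _ w n) => // G' v G'P Gv.
  apply: acc_almost_sub (sub_almost _ _ (zx1 z zx2)) _.
  apply: stable => [|nt]; last by apply: H; exists G', v.
  have G'V : all_VF (G ++ G') by apply: all_VF_cat => // g /G'P[_ []].
  split => //=; apply: all_VF_rcons => //; first exact: span_all_VF Dw.
  exact: span_all_VF Gv.
- by move=> D y G u t; have [gp _] := t; have [N NP] := x2Q _ gp t; exists N.
Qed.

(** * A subsequence that can be copied, and its uniform embeddings *)

Lemma sorted_blist (x : nat -> E) (I : seq nat) :
  bseq x -> sorted ltn I -> blist [seq x i | i <- I].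
Proof.
move=> [phi [incr xP]] sI.
exists (fun i => if (i < size I)%N then phi (nth 0%N I i) else phi (last 0%N I).+1).
have phile : {homo phi : i j / (i <= j)%N} by exact: incr_homo.
have nthlt i j : (i < j)%N -> (j < size I)%N -> (nth 0%N I i < nth 0%N I j)%N.
  by move=> ij jI; apply: (sorted_ltn_nth ltn_trans) => //; rewrite inE (ltn_trans ij).
have nthlast i : (i < size I)%N -> (nth 0%N I i <= last 0%N I)%N.
  move=> iI; rewrite -nth_last.
  have : (i <= (size I).-1)%N by rewrite -ltnS prednK// (leq_ltn_trans _ iI).
  rewrite leq_eqVlt => /orP[/eqP ->//|il]; apply: ltnW; apply: nthlt => //.
  by rewrite prednK// (leq_ltn_trans _ iI).
split => [i j ij|i].
  case: ifPn => iI; case: ifPn => jI => //.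
  - apply: phile; move: ij; rewrite leq_eqVlt => /orP[/eqP ->//|ij].
    by apply: ltnW; exact: nthlt.
  - by apply: phile; apply: leqW; exact: nthlast.
  - by move: iI; rewrite (leq_ltn_trans ij jI).
rewrite size_map => iI; rewrite (nth_map 0%N)// iI.
have [-> xs] := xP (nth 0%N I i); split => //; apply: seg_le xs => //.
by case: ifP => iI'; apply: phile; [exact: nthlt|rewrite ltnS nthlast].
Qed.

Section Tau.
Variables (C : R) (x : nat -> E).
Variable tau : seq E -> seq E -> seq E -> seq E -> Prop.
Hypothesis xb : bseq x.
Hypothesis tau0 : tau [::] [::] [::] [::].
Hypothesis tauE : forall D y G u, tau D y G u -> equivalent C y u.
Hypothesis tau_pick : forall D y G u w z n,
  tau D y G u -> fspan [set` D] w -> sub z x ->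
  exists G' v, [/\ forall g, g \in G' -> fspan (range z) g /\ tail n g,
    fspan [set` G ++ G'] v & tau D (rcons y w) (G ++ G') (rcons u v)].
Hypothesis tau_draw : forall D y G u, tau D y G u -> exists N, forall vs,
  (forall v, v \in vs -> fspan (range x) v /\ tail N v) ->
  blist (D ++ vs) -> tau (D ++ vs) y G u.

(** [s.1] lists the indices chosen so far and [s.2] finitely many partial copies. Each copy records
    a play in which the picks are the drawn vectors themselves, in order; it may lag behind the
    draws. *)
Let Inv (s : seq nat * seq (seq E * seq E)) := let D := [seq x i | i <- s.1] in
  sorted ltn s.1 /\ forall q, q \in s.2 ->
    (size q.2 <= size s.1)%N /\ tau D (take (size q.2) D) q.1 q.2.

Let Reply n (q r : seq E * seq E) := exists G' v,
  [/\ r = (q.1 ++ G', rcons q.2 v),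
      forall g, g \in G' -> fspan (range x) g /\ tail n g &
      fspan [set` q.1 ++ G'] v].

(** Old copies are kept next to their extensions, so that each one is extended again at every later
    stage, with larger and larger bounds. *)
Let Step (s t : seq nat * seq (seq E * seq E)) :=
  [/\ exists i, t.1 = rcons s.1 i, {subset s.2 <= t.2} &
      forall q, q \in s.2 -> exists2 r, r \in t.2 & Reply (size s.1) q r].

(** Only finitely many copies are under way, so one bound [N] makes the next drawn block legal in
    all their plays. *)
Lemma extend_target s : Inv s -> exists2 t, Inv t & Step s t.
Proof.
case: s => I Rel [/= sI RelP]; pose D := [seq x i | i <- I].
have [N NP] : exists N, forall q, q \in Rel -> forall vs,
    (forall v, v \in vs -> fspan (range x) v /\ tail N v) ->
    blist (D ++ vs) -> tau (D ++ vs) (take (size q.2) D) q.1 q.2.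
  elim: Rel RelP => [|q Rel IH] RelP; first by exists 0%N.
  have [|N NP] := IH; first by move=> p pR; apply: RelP; rewrite inE pR orbT.
  have [_ /tau_draw[M MP]] := RelP q (mem_head _ _).
  exists (maxn M N) => p; rewrite inE => /orP[/eqP ->|/NP{}NP] vs vsP.
    apply: MP => v /vsP[vx vt]; split => //.
    by apply: tail_le vt; rewrite leq_maxl.
  apply: NP => v /vsP[vx vt]; split => //.
  by apply: tail_le vt; rewrite leq_maxr.
pose i := maxn N (last 0%N I).+1.
have sI' : sorted ltn (rcons I i).
  have li : (last 0%N I < i)%N by rewrite leq_max leqnn orbT.
  by case: (I) sI li => //= a J; rewrite rcons_path => -> /=.
have D'E : [seq x i | i <- rcons I i] = D ++ [:: x i] by rewrite map_rcons cats1.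
have tD' q : q \in Rel -> tau (D ++ [:: x i]) (take (size q.2) D) q.1 q.2.
  move=> qR; apply: NP => //; last by rewrite -D'E; exact: sorted_blist.
  move=> v; rewrite inE => /eqP ->; split; first by apply: (kspan_incl Fr); exists i.
  by apply: tail_le (bseq_tail _ i xb); rewrite leq_maxl.
have takeD q : q \in Rel -> take (size q.2) (D ++ [:: x i]) = take (size q.2) D.
  by move=> /RelP[sz _]; rewrite takel_cat// size_map.
have [|Rel' [Rel'1 Rel'2]] := @list_choice _ (fun q r => Reply (size I) q r /\
    tau (D ++ [:: x i]) (take (size r.2) (D ++ [:: x i])) r.1 r.2) Rel.
  move=> q qR; have [sz _] := RelP q qR.
  have szD : (size q.2 < size (D ++ [:: x i]))%N by rewrite size_cat size_map addn1.
  have [||G' [v [G'P Gv t]]] :=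
    tau_pick _ _ _ _ (D ++ [:: x i])`_(size q.2) x (size I) (tD' q qR).
  - by apply: (kspan_incl Fr) => /=; exact: mem_nth.
  - exact: sub_refl.
  exists (q.1 ++ G', rcons q.2 v); split; first by exists G', v.
  by rewrite /= size_rcons (take_nth 0)// takeD.
exists (rcons I i, Rel ++ Rel'); last first.
  split => /=; first by exists i.
  - by move=> q qR; rewrite mem_cat qR.
  - by move=> q /Rel'1[r rR [qr _]]; exists r => //; rewrite mem_cat rR orbT.
split => //= q; rewrite mem_cat D'E => /orP[qR|/Rel'2[p pR [pq tq]]].
  split; first by rewrite size_rcons; apply: leqW; case: (RelP q qR).
  by rewrite takeD//; exact: tD'.
split => //; case: pq => G' [v [-> _ _]] /=; rewrite !size_rcons ltnS.
by case: (RelP p pR).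
Qed.

Lemma target_subsequence : exists psi : nat -> nat,
  (forall k, (psi k < psi k.+1)%N) /\
  exists H : seq E -> seq E -> Prop, H [::] [::] /\
  forall G w, H G w -> equivalent C [seq x (psi i) | i <- iota 0 (size w)] w /\
    forall n, exists G' v, [/\ forall g, g \in G' -> fspan (range x) g /\ tail n g,
      fspan [set` G ++ G'] v & H (G ++ G') (rcons w v)].
Proof.
have [||f f0 fP] := @dependent_choice_in _ Inv Step ([::], [:: ([::], [::])]).
- by split => // q; rewrite inE => /eqP ->.
- exact: extend_target.
have fsz n : size (f n).1 = n.
  elim: n => [|n IH]; first by rewrite f0.
  by have [_ [[i ->] _ _]] := fP n; rewrite size_rcons IH.
pose psi n := nth 0%N (f n.+1).1 n.
have fE n : (f n).1 = [seq psi i | i <- iota 0 n].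
  elim: n => [|n IH]; first by rewrite f0.
  have [_ [[i fi] _ _]] := fP n.
  rewrite -addn1 iotaD map_cat -IH /= cats1 add0n addn1 fi; congr rcons.
  by rewrite /psi fi nth_rcons fsz ltnn eqxx.
exists psi; split => [k|].
  have nthE i : (i < k.+2)%N -> nth 0%N (f k.+2).1 i = psi i.
    by move=> ik; rewrite fE (nth_map 0%N) ?size_iota// nth_iota.
  have [[fs _] _] := fP k.+2; rewrite -!nthE//.
  by apply: (sorted_ltn_nth ltn_trans) => //; rewrite inE fsz.
exists (fun G w => exists n, (G, w) \in (f n).2); split.
  by exists 0%N; rewrite f0 mem_head.
have mono n m G w : (n <= m)%N -> (G, w) \in (f n).2 -> (G, w) \in (f m).2.
  move=> /subnKC <- Gw; elim: (m - n)%N => [|k IH]; first by rewrite addn0.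
  by rewrite addnS; have [_ [_ sb _]] := fP (n + k)%N; exact: sb.
move=> G w [n Gw]; split.
  have [[_ /(_ _ Gw)[/= sz /tauE tE]] _] := fP n.
  rewrite fsz in sz; move: tE.
  by rewrite fE -map_comp -map_take take_iota (minn_idPl sz).
(* A copy made by stage [n] is still present at stage [maxn n m], where it is extended beyond a
   bound of at least [m]. *)
move=> m; have nm := mono _ _ _ _ (leq_maxl n m) Gw.
have [_ [_ _ /(_ _ nm)[r rR [G' [v [rE G'P Gv]]]]]] := fP (maxn n m).
exists G', v; split => //; last by exists (maxn n m).+1; rewrite -rE.
move=> g /G'P[gx gt]; split => //; apply: tail_le gt.
by rewrite fsz leq_maxr.
Qed.

End Tau.

Lemma equivalent_mkseq (C : R) (f g : nat -> E) n :
  equivalent C (mkseq f n) (mkseq g n) -> forall a : nat -> R,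
  `|\sum_(i < n) a i *: f i| <= C * `|\sum_(i < n) a i *: g i| /\
  `|\sum_(i < n) a i *: g i| <= C * `|\sum_(i < n) a i *: f i|.
Proof.
move=> fg a; have := fg a; rewrite size_mkseq.
have E' (h : nat -> E) : \sum_(i < n) a i *: (mkseq h n)`_i = \sum_(i < n) a i *: h i.
  by apply: eq_bigr => i _; rewrite nth_mkseq.
by rewrite !E'.
Qed.

(* Two plays are run in parallel: [H] embeds [l] into [x], and [tau] moves the
   image into [M]. The answers in the first play are requested far enough for
   the blocks of [x] spanning them to be legal draws in the second one. *)
Lemma uniform_target (C : R) x0 : 0 <= C -> bseq x0 ->
  (forall x, sub x x0 -> ~ acc C x [::] [::] [::] [::]) ->
  exists2 l, bseq l & forall M, sub M l -> exists2 c : nat -> E,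
    forall k, fspan (range M) (c k) &
    forall n (a : nat -> R),
      `|\sum_(i < n) a i *: l i| <= C * C * `|\sum_(i < n) a i *: c i| /\
      `|\sum_(i < n) a i *: c i| <= C * C * `|\sum_(i < n) a i *: l i|.
Proof.
move=> C0 x0b rej.
have [x [tau [[xx0 tau0] tauE tau_pick tau_draw]]] := opponent_strategy C x0 x0b rej.
have xb : bseq x by case: xx0.
have [psi [psi_incr [H [H0 HP]]]] := target_subsequence C x tau xb tau0 tauE tau_pick tau_draw.
exists (x \o psi) => [|M Ml]; first exact: bseq_subseq.
have Mx : sub M x by apply: (sub_trans _ _ _ Ml); exact: sub_subseq.
have [phi xphi] := xb.
pose T := (seq E * seq E * seq nat * seq E * seq E)%type.
(* [G1], [w] is the copy of [l] in the first play; in the second one the draws are the blocks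
   indexed by [K], the picks are [w], and [G2], [v] are the answers inside [M]. *)
pose Inv (s : T) := let: (G1, w, K, G2, v) := s in
  [/\ H G1 w, tau [seq x i | i <- K] w G2 v, sorted ltn K,
     forall g, g \in G1 -> fspan [set` [seq x i | i <- K]] g &
     forall g, g \in G2 ++ v -> fspan (range M) g].
pose Step (s t : T) := let: (G1, w, K, G2, v) := s in let: (G1', w', K', G2', v') := t in
  (exists a, w' = rcons w a) /\ (exists a, v' = rcons v a).
have [||f f0 fP] := @dependent_choice_in T Inv Step ([::], [::], [::], [::], [::]).
- by split.
- move=> [[[[G1 w] K] G2] v] [Hw t sI G1P G2P].
  have [N NP] := tau_draw _ _ _ _ t.
  pose i0 := maxn N (last 0%N K).+1.
  (* Vectors of the span of [x] that vanish below [phi i0] only involve blocks of index at least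
     [i0], and these come after [K] and beyond [N]. *)
  have [G' [a [G'P Ga H']]] := (HP _ _ Hw).2 (phi i0).
  have [m mP] := bseq_at_span_list x phi i0 G' xphi G'P.
  pose K' := K ++ index_iota i0 m.
  have sI' : sorted ltn K'.
    have li : (last 0%N K < i0)%N by rewrite leq_max leqnn orbT.
    rewrite /K'; case: (K) sI li => [|b J0] //= sJ li.
      exact: iota_ltn_sorted.
    rewrite cat_path sJ /=; have : sorted ltn (index_iota i0 m) by exact: iota_ltn_sorted.
    rewrite /index_iota; case: (m - i0)%N => [|k] /=; [by []|move=> ->].
    by rewrite andbT.
  have t' : tau [seq x i | i <- K'] w G2 v.
    rewrite map_cat; apply: NP; last by rewrite -map_cat; exact: sorted_blist.
    move=> _ /mapP[i + ->]; rewrite mem_index_iota => /andP[i0i _].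
    split; first by apply: (kspan_incl Fr); exists i.
    by apply: tail_le (bseq_tail _ i xb); rewrite (leq_trans _ i0i)// leq_maxl.
  have K'P g : g \in G1 ++ G' -> fspan [set` [seq x i | i <- K']] g.
    rewrite mem_cat => /orP[/G1P|/mP]; apply: kspan_subseq => h;
      by rewrite map_cat mem_cat => ->; rewrite ?orbT.
  have K'a : fspan [set` [seq x i | i <- K']] a by apply: (kspan_trans Fr) Ga.
  have [G2' [c [G2'P Gc t'']]] := tau_pick _ _ _ _ a M 0%N t' K'a Mx.
  exists (G1 ++ G', rcons w a, K', G2 ++ G2', rcons v c); last by split; [exists a|exists c].
  have G2P' g : g \in G2 ++ G2' -> fspan (range M) g.
    rewrite mem_cat => /orP[gG|/G2'P[]//]; apply: G2P; by rewrite mem_cat gG.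
  split => // g; rewrite mem_cat => /orP[/G2P'//|]; rewrite mem_rcons inE => /orP[/eqP ->|gv].
    by apply: (kspan_trans Fr) Gc.
  by apply: G2P; rewrite mem_cat gv orbT.
pose w n := (f n).1.1.1.2; pose v n := (f n).2.
have wE := rcons_limit _ 0 w; have vE := rcons_limit _ 0 v.
have {}wE n : w n = mkseq (fun k => nth 0 (w k.+1) k) n.
  apply: wE => [|k]; first by rewrite /w f0.
  have [_] := fP k; rewrite /w /Step; case: (f k) => [[[[? ?] ?] ?] ?].
  by case: (f k.+1) => [[[[? ?] ?] ?] ?] [].
have {}vE n : v n = mkseq (fun k => nth 0 (v k.+1) k) n.
  apply: vE => [|k]; first by rewrite /v f0.
  have [_] := fP k; rewrite /v /Step; case: (f k) => [[[[? ?] ?] ?] ?].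
  by case: (f k.+1) => [[[[? ?] ?] ?] ?] [].
exists (fun k => nth 0 (v k.+1) k).
  move=> k; have sz : size (v k.+1) = k.+1 by rewrite vE size_mkseq.
  have [+ _] := fP k.+1; move: sz; rewrite /v /Inv.
  case: (f k.+1) => [[[[G1 w'] K] G2] v'] /= sz [_ _ _ _ H2].
  by apply: H2; rewrite mem_cat mem_nth ?orbT// sz.
move=> n a.
have [lw wv] : equivalent C (mkseq (x \o psi) n) (w n) /\ equivalent C (w n) (v n).
  have sz : size (w n) = n by rewrite wE size_mkseq.
  have [+ _] := fP n; move: sz; rewrite /w /v /Inv.
  case: (f n) => [[[[G1 w'] K] G2] v'] /= sz [/HP[+ _] /tauE wv _ _ _].
  by rewrite sz.
rewrite wE in lw wv; rewrite vE in wv.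
have [l1 l2] := equivalent_mkseq _ _ _ _ lw a.
have [c1 c2] := equivalent_mkseq _ _ _ _ wv a.
split.
  by apply: le_trans l1 _; rewrite -mulrA ler_wpM2l.
by apply: le_trans c2 _; rewrite -mulrA ler_wpM2l.
Qed.

(** * Minimality *)

Lemma span_dense (A : set E) v (eps : R) : 0 < eps -> kspan predT A v ->
  exists2 u, fspan A u & `|v - u| < eps.
Proof.
move=> eps0 Av; elim: Av eps eps0 => [|a u w _ Au _ IH] eps eps0.
  by exists 0; [exact: kspan0|rewrite subrr normr0].
have [w' Aw' ww'] := IH (eps / 2) ltac:(exact: divr_gt0).
have u1 : 0 < `|u| + 1 by rewrite ltr_wpDl.
have e0 : 0 < eps / 2 / (`|u| + 1) by rewrite !divr_gt0.
have [q qF aq] := field_dense a _ e0.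
exists (q *: u + w'); first exact: kspan_cons.
rewrite opprD addrACA -scalerBl (splitr eps).
apply: le_lt_trans (ler_normD _ _) _; apply: ltr_leD; last exact: ltW.
rewrite normrZ; move: aq; rewrite ltr_pdivlMr//.
by apply: le_lt_trans; rewrite ler_wpM2l// lerDl.
Qed.

Lemma span_bcoef0 (A : set E) v i : (forall u, A u -> bcoef u i = 0) ->
  kspan predT A v -> bcoef v i = 0.
Proof.
move=> A0; elim=> [|a u w _ Au _ IH]; first exact: bcoef0.
by rewrite bcoef_linear IH A0// mulr0 addr0.
Qed.

(** As [Y] is infinite-dimensional, it contains a unit vector [y] vanishing below [phi N]. A
    combination [p] of the [l k] close to [y] may have a part before [N], but this part is a basis
    projection of [p - y], hence small. *)
Lemma near_block (l : nat -> E) phi (Y : set E) N (eps : R) : 0 < eps ->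
  bseq_at l phi -> closed_subspace Y -> ~ finite_dimensional Y ->
  Y `<=` closed_span (range l) ->
  exists y M, [/\ Y y, `|M| = 1, fspan (range l) M, tail (phi N) M & `|y - M| <= eps].
Proof.
move=> eps0 lphi [YL _] Yinf Yl; have pT := subring_predT R.
have [b b1 bP] := bproj_bounded.
have b0 : 0 < b by apply: lt_le_trans b1.
have [y0 [Yy0 y00 y0c]] : exists y, [/\ Y y, y != 0 &
    forall i, (i < phi N)%N -> bcoef y i = 0].
  apply: contrapT => H; apply: Yinf.
  apply: (finite_codim (phi N) (fun i v => bcoef v i)) => //.
    by move=> i a u v; exact: bcoef_linear.
  move=> y Yy yc; apply/eqP; apply: contrapT => /negP y0.
  by apply: H; exists y.
pose y := `|y0|^-1 *: y0.
have yn : `|y| = 1 by rewrite normrZ normfV normr_id mulVf// normr_eq0.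
have Yy : Y y.
  have /linear_subspaceP[Y0 YL'] := YL.
  by rewrite /y -[_ *: _]addr0; exact: YL'.
have yc i : (i < phi N)%N -> bcoef y i = 0 by move=> iN; rewrite bcoefZ y0c// mulr0.
(* Reaching [u] costs [2 * d] and normalising it another [2 * d]; the cap [1 / 4] keeps [u] away
   from 0. *)
pose d := Num.min (eps / 4) (1 / 4).
have d0 : 0 < d by rewrite lt_min !divr_gt0.
have db : 0 < d / (1 + b) by rewrite divr_gt0// addr_gt0.
have := Yl y Yy; rewrite /closed_span lin_spanE => /closureP/(_ _ db)[p lp yp].
have linc : range l `<=` [set l k | k in [set k | (k < N)%N]] `|`
                        [set l k | k in [set k | (N <= k)%N]].
  by move=> _ [k _ <-]; case: (ltnP k N) => kN; [left|right]; exists k.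
have [h [t [hS tS pE]]] := kspan_setU _ _ _ (kspan_mono pT _ _ _ linc lp).
have phile : {homo phi : i j / (i <= j)%N} by apply: incr_homo; case: lphi.
have hE : h = bproj (phi N) (p - y).
  apply: eq_bcoef => i; rewrite bcoef_proj bcoefB pE bcoefD.
  case: ltnP => iN.
    rewrite yc// subr0 (span_bcoef0 _ _ _ _ tS) ?addr0// => _ [k Nk <-].
    have [_] := bseq_at_tail _ _ k lphi; apply; apply: leq_trans iN _.
    exact: phile.
  apply: (span_bcoef0 _ _ _ _ hS) => _ [k kN <-]; have [_ [_]] := lphi.2 k.
  by apply; rewrite negb_and -!leqNgt; apply/orP; right; apply: leq_trans iN; exact: phile.
have yt : `|y - t| < d.
  have -> : y - t = (y - p) + h by rewrite pE opprD addrA addrAC addrNK.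
  apply: le_lt_trans (ler_normD _ _) _.
  have hp : `|h| <= b * `|y - p| by rewrite hE distrC; exact: bP.
  apply: le_lt_trans (lerD (lexx _) hp) _.
  by rewrite -[X in X + _]mul1r -mulrDl mulrC -ltr_pdivlMr// addr_gt0.
have [u uS tu] := span_dense _ _ d d0 tS.
have yu : `|y - u| < 2 * d.
  rewrite -(subrK t y) -addrA mulr_natl mulr2n.
  by apply: le_lt_trans (ler_normD _ _) _; exact: ltrD.
have ul : fspan (range l) u by apply: (kspan_mono Fr) uS => _ [k _ <-]; exists k.
have lb : bseq l by exists phi.
have uV : VF u by exact: (bseq_span_VF _ _ lb ul).
have d4 : d <= 1 / 4 by rewrite ge_min lexx orbT.
have un : `| 1 - `|u| | < 2 * d by have := ler_dist_dist y u; rewrite yn => /le_lt_trans; apply.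
have u0 : 0 < `|u|.
  by move: un; rewrite ltr_norml => /andP[_]; lra.
have uF : `|u|^-1 \in F by apply: fieldV; exact: (VF_norm u uV).
exists y, (`|u|^-1 *: u); split => //.
- by rewrite normrZ normfV normr_id mulVf// gt_eqF.
- exact: (kspanZ Fr).
- have ut : tail (phi N) u.
    apply: tail_span uS => _ [k Nk <-]; apply: tail_le (bseq_at_tail _ _ k lphi).
    exact: phile.
  rewrite -[_ *: _]addr0; apply: tail_comb => //.
  exact: (seg_tail _ _ _ (seg0 (phi N) (phi N))).
have -> : y - `|u|^-1 *: u = (y - u) + (1 - `|u|^-1) *: u.
  by rewrite scalerBl scale1r addrA addrNK.
apply: le_trans (ler_normD _ _) _.
have -> : `|(1 - `|u|^-1) *: u| = `|1 - `|u| |.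
  rewrite normrZ -[X in _ * X]normr_id -normrM mulrBl mul1r mulVf ?gt_eqF//.
  exact: distrC.
apply: le_trans (lerD (ltW yu) (ltW un)) _.
have : d <= eps / 4 by rewrite ge_min lexx.
lra.
Qed.

Lemma gliding_hump (l : nat -> E) (Y : set E) (del : R) : 0 < del ->
  bseq l -> closed_subspace Y -> ~ finite_dimensional Y -> Y `<=` closed_span (range l) ->
  exists M y : nat -> E, [/\ sub M l, forall k, Y (y k) &
    forall k, `|y k - M k| <= del / 2 ^+ k.+1].
Proof.
move=> del0 [phi lphi] Yc Yinf Yl.
have lb : bseq l by exists phi.
pose Inv (s : E * E * nat * nat * nat) := let: (y, M, m, n, k) := s in
  [/\ Y y /\ fspan (range l) M, `|M| = 1 /\ (m < n)%N, seg m n M &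
      `|y - M| <= del / 2 ^+ k.+1].
pose Step (s t : E * E * nat * nat * nat) := let: (_, _, m, n, k) := s in
  let: (_, _, m', n', k') := t in m' = n /\ k' = k.+1.
have mk m k : exists s, Inv s /\ let: (_, _, m', _, k') := s in m' = m /\ k' = k.
  have eps0 : 0 < del / 2 ^+ k.+1 by rewrite divr_gt0// exprn_gt0.
  have [y [M [Yy Mn Ml Mt yM]]] := near_block l phi Y m _ eps0 lphi Yc Yinf Yl.
  have mphi : (m <= phi m)%N by apply: incr_ge; case: lphi.
  have [n nP] := tail_seg _ _ (tail_le _ _ _ mphi Mt).
  exists (y, M, m, maxn n m.+1, k); split => //; split => //.
    by rewrite leq_max leqnn orbT.
  by apply: nP; rewrite leq_maxl.
have [s0 [s0P s0E]] := mk 0%N 0%N.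
have [//||f f0 fP] := @dependent_choice_in _ Inv Step s0.
  move=> [[[[y M] m] n] k] _; have [s [sP sE]] := mk n k.+1.
  by exists s => //; case: s sP sE => [[[[? ?] ?] ?] ?].
exists (fun k => (f k).1.1.1.2), (fun k => (f k).1.1.1.1).
have fk k : (f k).2 = k.
  elim: k => [|k IH]; first by rewrite f0; case: (s0) s0E => [[[[? ?] ?] ?] ?] [].
  have [_] := fP k; rewrite /Step; move: IH; case: (f k) => [[[[? ?] ?] ?] ?] /= ->.
  by case: (f k.+1) => [[[[? ?] ?] ?] ?] [_ ->].
split=> [|k|k].
- split; last by move=> k; have [+ _] := fP k; case: (f k) => [[[[? ?] ?] ?] ?] [[]].
  exists (fun k => (f k).1.1.2); split=> k; have [+ +] := fP k; rewrite /Step /Inv;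
    case: (f k) => [[[[? ?] ?] ?] ?] /=; case: (f k.+1) => [[[[? ?] ?] ?] ?] /=.
    by move=> [_ [_ +] _ _] [-> _].
  by move=> [_ [-> _] + _] [-> _].
- by have [+ _] := fP k; case: (f k) => [[[[? ?] ?] ?] ?] [[]].
- have [+ _] := fP k; rewrite -[in X in _ <= X](fk k).
  by case: (f k) => [[[[? ?] ?] ?] ?] [].
Qed.

Lemma minimal_of_target (l : nat -> E) (K : R) : 0 <= K -> bseq l ->
  (forall M, sub M l -> exists2 c : nat -> E, forall k, fspan (range M) (c k) &
    forall n (a : nat -> R),
      `|\sum_(i < n) a i *: l i| <= K * `|\sum_(i < n) a i *: c i| /\
      `|\sum_(i < n) a i *: c i| <= K * `|\sum_(i < n) a i *: l i|) ->
  minimal_space (closed_span (range l)).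
Proof.
move=> K0 lb lP Y Yc Yinf Yl; have pT := subring_predT R.
have [b b1 bP] := bproj_bounded.
have b0 : 0 < b by apply: lt_le_trans b1.
(* With this tolerance the factor [2 * b * del] of [succ_blocks_perturb] is 1/2, so replacing [M] by
   [y] changes norms by a factor of at most 2. *)
have del0 : 0 < (4 * b)^-1 by rewrite invr_gt0 mulr_gt0.
have [M [y [Ml Yy yM]]] := gliding_hump l Y _ del0 lb Yc Yinf Yl.
have [c cM lc] := lP M Ml.
have [[phi Mphi] _] := Ml.
pose P (p : E * E) := kspan (@predT R) (range (fun k => (M k, y k))) p.
have pert p : P p -> `|p.2 - p.1| <= 2^-1 * `|p.1|.
  move=> /kspan_fst_snd[n [a [-> ->]]]; rewrite -sumrB.
  under eq_bigr do rewrite -scalerBr.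
  have sM : succ_blocks n M phi by exact: bseq_at_succ.
  apply: le_trans (succ_blocks_perturb b n M phi a _ _ bP (ltW b0) (ltW del0) sM
    (fun i _ => yM i)) _.
  rewrite le_eqVlt; apply/orP; left; apply/eqP; field; rewrite gt_eqF//.
(* [d k] combines the [y i] with the coefficients that [c k] has on the [M i]. *)
have /choice[d dP] (k : nat) : exists d, P (c k, d).
  have /(kspan_rangeP Fr)[n [a _ ->]] := cM k.
  by exists (\sum_(i < n) a i *: y i); apply/kspan_fst_snd; exists n, a.
have Pcd n (a : nat -> R) : P (\sum_(i < n) a i *: c i, \sum_(i < n) a i *: d i).
  elim: n => [|n IH]; first by rewrite !big_ord0; exact: kspan0.
  rewrite !big_ord_recr /=.
  exact: (kspanD _ _ _ IH (kspanZ pT _ _ _ isT (dP n))).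
exists (closed_span (range d)); split; first exact: closed_span_subspace.
  apply: closed_span_min => // _ [k _ <-].
  have /linear_subspaceP[Y0 YL] := Yc.1.
  have /kspan_fst_snd[n [a [_ /= ->]]] := dP k.
  by elim/big_rec: _ => // i v _ Yv; exact: YL.
apply: (equivalent_isomorphic _ _ (K * 2)); first exact: mulr_ge0.
move=> n a; have [l1 l2] := lc n a.
have /= := pert _ (Pcd n a).
set p := \sum_(i < n) _ *: c i in l1 l2 *; set q := \sum_(i < n) _ *: d i => pq.
have pq1 : `|p| <= 2 * `|q|.
  have : `|p| <= `|q - p| + `|q| by rewrite distrC -{1}(subrK q p) ler_normD.
  lra.
have pq2 : `|q| <= 2 * `|p|.
  have : `|q| <= `|q - p| + `|p| by rewrite -{1}(subrK p q) ler_normD.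
  have := normr_ge0 p; lra.
split.
  by apply: le_trans l1 _; rewrite -mulrA ler_wpM2l.
by apply: le_trans pq2 _; rewrite [K * 2]mulrC -mulrA ler_wpM2l.
Qed.

Lemma minimal_of_rejection (C : R) x0 : 0 <= C -> bseq x0 ->
  (forall x, sub x x0 -> ~ acc C x [::] [::] [::] [::]) ->
  exists2 l, bseq l & minimal_space (closed_span (range l)).
Proof.
move=> C0 x0b /(uniform_target _ _ C0 x0b)[l lb lP]; exists l => //.
by apply: (minimal_of_target l (C * C)) => //; exact: mulr_ge0.
Qed.

(** * Continuous tightness *)

(** [acc] is a proposition and cannot be eliminated into data, while the intervals are computed from
    what a strategy does. [strat] is the tree of moves as data, extracted by choice in
    [acc_wins]. *)
Inductive strat :=
| Stop
| Draw (S : set (seq E)) (next : seq E -> strat)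
| Pick (w : E) (n : nat) (next : seq E -> E -> strat).

Fixpoint wins (C : R) (x : nat -> E) (s : strat) (D y G u : seq E) : Prop :=
  match s with
  | Stop => ~ equivalent C y u
  | Draw Q next =>
      (forall z, sub z x -> exists vs, [/\ forall v, v \in vs -> fspan (range z) v,
         blist (D ++ vs) & Q vs]) /\
      forall vs, Q vs -> wins C x (next vs) (D ++ vs) y G u
  | Pick w n next => fspan [set` D] w /\
      forall G' v, (forall g, g \in G' -> fspan (range x) g /\ tail n g) ->
        fspan [set` G ++ G'] v ->
        wins C x (next G' v) D (rcons y w) (G ++ G') (rcons u v)
  end.

Lemma acc_wins C x D y G u : acc C x D y G u -> exists s, wins C x s D y G u.
Proof.
elim=> {D y G u} [D y G u bad|D y G u S drw _ IH|D y G u w n Dw _ IH].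
- by exists Stop.
- have /choice[next nextP] (vs : seq E) : exists s, S vs -> wins C x s (D ++ vs) y G u.
    have [Svs|nS] := pselect (S vs); last by exists Stop.
    by have [s sP] := IH vs Svs; exists s.
  by exists (Draw S next).
- have /choice[next nextP] (p : seq E * E) : exists s,
      (forall g, g \in p.1 -> fspan (range x) g /\ tail n g) ->
      fspan [set` G ++ p.1] p.2 ->
      wins C x s D (rcons y w) (G ++ p.1) (rcons u p.2).
    have [G'P|nG] := pselect (forall g, g \in p.1 -> fspan (range x) g /\ tail n g);
      last by exists Stop.
    have [Gv|nGv] := pselect (fspan [set` G ++ p.1] p.2); last by exists Stop.
    by have [s sP] := IH p.1 p.2 G'P Gv; exists s.
  exists (Pick w n (fun G' v => next (G', v))); split => // G' v G'P Gv.
  exact: (nextP (G', v)).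
Qed.

(* Drawing from the shortest initial part of [Y] that allows it makes the draw a
   locally constant function of [Y]. *)
Definition drawable (D : seq E) (S : set (seq E)) (p : seq E) : set (seq E) :=
  [set vs : seq E | [/\ forall v, v \in vs -> fspan [set` p] v, blist (D ++ vs) & S vs]].

Definition draw_time D S (Y : nat -> E) : nat := xget 0%N [set k |
  drawable D S (mkseq Y k) !=set0 /\
  forall j, (j < k)%N -> ~ (drawable D S (mkseq Y j) !=set0)].

Definition drawn D S (Y : nat -> E) : seq E :=
  xget [::] (drawable D S (mkseq Y (draw_time D S Y))).

Lemma draw_timeP D S Y k : drawable D S (mkseq Y k) !=set0 ->
  drawable D S (mkseq Y (draw_time D S Y)) !=set0 /\
  forall j, (j < draw_time D S Y)%N -> ~ (drawable D S (mkseq Y j) !=set0).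
Proof.
move=> dk.
have ex : exists k, `[< drawable D S (mkseq Y k) !=set0 >] by exists k; apply/asboolP.
have [m /asboolP dm mmin] := ex_minnP ex.
have P0 : [set k | drawable D S (mkseq Y k) !=set0 /\
    forall j, (j < k)%N -> ~ (drawable D S (mkseq Y j) !=set0)] m.
  split => // j jm dj; have := mmin j (asboolT dj).
  by rewrite leqNgt jm.
exact: (xgetI 0%N P0).
Qed.

(** A sequence agreeing with [Y] up to [draw_time] has the same draw time, hence the same set of
    drawable lists, in which [xget] selects the same element. *)
Lemma drawnP D S Y x : sub Y x ->
  (forall z, sub z x -> exists vs, [/\ forall v, v \in vs -> fspan (range z) v,
         blist (D ++ vs) & S vs]) ->
  drawable D S (mkseq Y (draw_time D S Y)) (drawn D S Y) /\
  forall Y', (forall i, (i < draw_time D S Y)%N -> Y' i = Y i) ->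
    drawn D S Y' = drawn D S Y.
Proof.
move=> Yx drw; have [vs [vsY Dvs Svs]] := drw Y Yx.
have [k dk] : exists k, drawable D S (mkseq Y k) !=set0.
  have [k kP] : exists k, forall v, v \in vs -> fspan [set` mkseq Y k] v.
    elim: vs vsY {Dvs Svs} => [|v vs IH] vsY; first by exists 0%N.
    have [|k kP] := IH; first by move=> w wvs; apply: vsY; rewrite inE wvs orbT.
    have [m mP] := kspan_range_fin Fr _ _ (vsY v (mem_head _ _)).
    exists (maxn m k) => w; rewrite inE => /orP[/eqP ->|/kP].
      by apply: mP; rewrite leq_maxl.
    apply: kspan_subseq => g /mapP[i + ->]; rewrite mem_iota /= add0n => ik.
    by apply/mapP; exists i => //; rewrite mem_iota /= add0n leq_max ik orbT.
  by exists k, vs.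
have [[vs' vs'P] tmin] := draw_timeP _ _ _ _ dk.
split; first exact: (xgetI _ vs'P).
move=> Y' YY.
have pre j : (j <= draw_time D S Y)%N -> mkseq Y' j = mkseq Y j.
  move=> jt; apply/eq_in_map => i; rewrite mem_iota /= add0n => ij.
  by apply: YY; exact: leq_trans jt.
have d' : drawable D S (mkseq Y' (draw_time D S Y)) !=set0.
  by exists vs'; rewrite pre.
have [t'P t'min] := draw_timeP _ _ _ _ d'.
suff tE : draw_time D S Y' = draw_time D S Y by rewrite /drawn tE pre.
apply/eqP; rewrite eqn_leq; apply/andP; split; rewrite leqNgt; apply/negP => lt.
  exact: (t'min _ lt).
by apply: (tmin _ lt); rewrite -pre// ltnW.
Qed.

(** * Responses of a strategy to coded answers *)

Section Response.
Variables (dec : nat -> E) (x : nat -> E).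

(** The bound that [s] sets once the answers in [h] are used up. An answer is the end of a gap
    together with the code of a vector; the opponent is given all blocks of [x] from the current
    bound to the end of the gap. The value 0 stands for a finished play or an illegal answer. *)
Fixpoint response (Y : nat -> E) (h : seq (nat * nat)) (s : strat) (D G : seq E) : nat :=
  match s with
  | Stop => 0%N
  | Draw Q next => response Y h (next (drawn D Q Y)) (D ++ drawn D Q Y) G
  | Pick w n next => if h is p :: h' then
      let G' := [seq x i | i <- index_iota n p.1] in
      if `[< fspan [set` G ++ G'] (dec p.2) >] then
        response Y h' (next G' (dec p.2)) D (G ++ G')
      else 0%N
    else n
  end.

Lemma legal_reply n m : bseq x -> forall g, g \in [seq x i | i <- index_iota n m] ->
  fspan (range x) g /\ tail n g.
Proof.
move=> xb _ /mapP[i + ->]; rewrite mem_index_iota => /andP[ni _].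
split; first by apply: (kspan_incl Fr); exists i.
by apply: tail_le (bseq_tail _ i xb).
Qed.

(** On the branch selected by [h], [Y] is consulted only by finitely many draws, each depending on
    finitely many of its terms. *)
Lemma response_determined C s D y G u h Y : bseq x -> sub Y x -> wins C x s D y G u ->
  exists N, forall Y', (forall i, (i < N)%N -> Y' i = Y i) ->
    response Y' h s D G = response Y h s D G.
Proof.
move=> xb Yx; elim: s D y G u h => [|S next IH|w n next IH] D y G u h /=.
- by move=> _; exists 0%N.
- move=> [drw nextP]; have [[_ _ Sd] dP] := drawnP _ _ _ _ Yx drw.
  have [N NP] := IH _ _ _ _ _ h (nextP _ Sd).
  exists (maxn N (draw_time D S Y)) => Y' YY; rewrite dP => [|i id].
    by apply: NP => i iN; apply: YY; rewrite leq_max iN.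
  by apply: YY; rewrite leq_max id orbT.
- move=> [Dw nextP]; case: h => [|[m k] h]; first by exists 0%N.
  case: asboolP => [Gk|nG] /=; last by exists 0%N.
  exact: IH (nextP _ _ (legal_reply n m xb) Gk).
Qed.

End Response.

(** * Intervals read off the strategies *)

Section Intervals.
Variables (dec : nat -> E) (x : nat -> E) (phi : nat -> nat) (sigma : nat -> nat -> strat).
Hypothesis decP : forall v, VF v -> exists k, dec k = v.
Hypothesis xphi : bseq_at x phi.
Hypothesis sigmaP : forall c N,
  wins c%:R x (sigma c N) [::] [::] [seq e i | i <- iota 0 N] [::].

Definition reply Y h c N :=
  response dec x Y h (sigma c N) [::] [seq e i | i <- iota 0 N].

(* [s] lists the left endpoints of the intervals up to the [j]-th one. A code
   stands for a constant [c] and, except before the first answer, for the gap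
   [l0] opened first, the earlier answers [h] and the code [k] of the last
   answer; an answer is a vector together with the interval ending its gap. *)
Definition code_value Y (s : seq nat) j q : nat :=
  match (unpickle q : option (nat * option (nat * seq (nat * nat) * nat))) with
  | Some (c, None) => reply Y [::] c (phi (nth 0%N s j))
  | Some (c, Some (l0, h, k)) =>
      reply Y (rcons [seq (nth 0%N s p.1, p.2) | p <- h] (nth 0%N s j, k)) c
        (phi (nth 0%N s l0))
  | None => 0%N
  end.

(** Interval [j] outlasts the bounds attached to all codes [q <= j], so any given code is taken care
    of by all intervals from some index on. *)
Definition right_end Y s j := (nth 0%N s j + \max_(q < j.+1) code_value Y s j q).+1.

(** The whole list is carried along because codes refer to intervals by index and need their left
    endpoints. *)
Fixpoint starts Y j :=
  if j is i.+1 then rcons (starts Y i) (right_end Y (starts Y i) i).+1 else [:: 0%N].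

Definition left_pt Y j := nth 0%N (starts Y j) j.

Definition right_pt Y j := right_end Y (starts Y j) j.

Definition endpoints Y n := if odd n then right_pt Y n./2 else left_pt Y n./2.

Lemma size_starts Y j : size (starts Y j) = j.+1.
Proof. by elim: j => //= j IH; rewrite size_rcons IH. Qed.

Lemma nth_starts Y i j : (i <= j)%N -> nth 0%N (starts Y j) i = left_pt Y i.
Proof.
move=> /subnKC <-; elim: (j - i)%N => [|k IH]; first by rewrite addn0.
by rewrite addnS /= nth_rcons size_starts ltnS leq_addr.
Qed.

Lemma left_ptS Y j : left_pt Y j.+1 = (right_pt Y j).+1.
Proof. by rewrite /left_pt /= nth_rcons size_starts ltnn eqxx. Qed.

Lemma left_lt_right Y j : (left_pt Y j < right_pt Y j)%N.
Proof. by rewrite /right_pt /right_end ltnS leq_addr. Qed.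

Lemma endpoints_incr Y n : (endpoints Y n < endpoints Y n.+1)%N.
Proof.
rewrite /endpoints /=; case: (boolP (odd n)) => on /=.
  by rewrite uphalf_half on add1n left_ptS.
by rewrite uphalf_half (negbTE on) add0n left_lt_right.
Qed.

Lemma left_pt_ge Y j : (j <= left_pt Y j)%N.
Proof.
elim: j => // j IH; rewrite left_ptS ltnS.
by apply: ltnW; apply: leq_ltn_trans (left_lt_right Y j).
Qed.

Lemma code_value_le Y j q : (q <= j)%N -> (code_value Y (starts Y j) j q <= right_pt Y j)%N.
Proof.
move=> qj; rewrite /right_pt /right_end; apply: leqW; apply: leq_trans (leq_addl _ _).
exact: (leq_bigmax (Ordinal (qj : (q < j.+1)%N))).
Qed.

Let xb : bseq x. Proof. by exists phi. Qed.

Lemma reply_determined Y h c N : sub Y x -> exists M, forall Y',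
  (forall i, (i < M)%N -> Y' i = Y i) -> reply Y' h c N = reply Y h c N.
Proof.
move=> Yx; exact: (response_determined dec x c%:R _ _ _ _ _ _ _ xb Yx (sigmaP c N)).
Qed.

Lemma right_end_determined Y s j : sub Y x -> exists M, forall Y',
  (forall i, (i < M)%N -> Y' i = Y i) -> right_end Y' s j = right_end Y s j.
Proof.
move=> Yx.
have /choice[m mP] (q : nat) : exists M, forall Y', (forall i, (i < M)%N -> Y' i = Y i) ->
    code_value Y' s j q = code_value Y s j q.
  rewrite /code_value; case: unpickle => [[c [[[l0 h] k]|]]|]; last by exists 0%N.
    exact: reply_determined.
  exact: reply_determined.
exists (\max_(q < j.+1) m q) => Y' YY; rewrite /right_end; congr (_ + _).+1.
apply: eq_bigr => q _; apply: mP => i im; apply: YY; apply: leq_trans im _.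
exact: (leq_bigmax q).
Qed.

Lemma starts_determined Y j : sub Y x -> exists M, forall Y',
  (forall i, (i < M)%N -> Y' i = Y i) -> starts Y' j = starts Y j.
Proof.
move=> Yx; elim: j => [|j [M MP]] /=; first by exists 0%N.
have [M' M'P] := right_end_determined Y (starts Y j) j Yx.
exists (maxn M M') => Y' YY; rewrite MP => [|i iM]; last first.
  by apply: YY; rewrite leq_max iM.
by rewrite M'P// => i iM; apply: YY; rewrite leq_max iM orbT.
Qed.

Lemma endpoints_determined Y n : sub Y x -> exists M, forall Y',
  (forall i, (i < M)%N -> Y' i = Y i) -> endpoints Y' n = endpoints Y n.
Proof.
move=> Yx; have [M MP] := starts_determined Y n./2 Yx.
have [M' M'P] := right_end_determined Y (starts Y n./2) n./2 Yx.
exists (maxn M M') => Y' YY; rewrite /endpoints /right_pt /left_pt MP => [|i iM].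
  by rewrite M'P// => i iM; apply: YY; rewrite leq_max iM orbT.
by apply: YY; rewrite leq_max iM.
Qed.

(** * A play against an embedding *)

Section Play.
Variables (Y : nat -> E) (A : set nat) (T : E -> E) (K b : R) (c : nat).
Hypothesis Yx : sub Y x.
Hypothesis Ainf : infinite_set A.
Hypotheses (K1 : 1 <= K) (b1 : 1 <= b) (cK : 2 * K <= c%:R).
Hypothesis bP : forall n v, `|bproj n v| <= b * `|v|.

Let X := closed_span (range Y).
Let allowed : set nat := ~` \bigcup_(i in A) [set m | (left_pt Y i <= m <= right_pt Y i)%N].

Hypothesis TL : linear_on X T.
Hypothesis TK : forall v, X v -> `|T v| <= K * `|v| /\ `|v| <= K * `|T v|.
Hypothesis TA : forall v, X v -> closed_span [set x n | n in allowed] (T v).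

(** [t] replaces the images of the drawn vectors by finite combinations over [F] of allowed blocks,
    which the opponent can actually play. *)
Let approx (D t : seq E) := [/\ size t = size D,
  forall i, (i < size D)%N -> `|t`_i - T D`_i| <= (4 * b * K)^-1 / 2 ^+ i.+1,
  forall v, v \in t -> fspan [set x n | n in allowed] v,
  forall v, v \in D -> fspan (range Y) v &
  blist D].

Let linked (D t : seq E) (p q : E) := exists d : nat -> R,
  p = \sum_(i < size D) d i *: D`_i /\ q = \sum_(i < size D) d i *: t`_i.

Let K0 : 0 < K. Proof. exact: lt_le_trans K1. Qed.
Let b0 : 0 < b. Proof. exact: lt_le_trans b1. Qed.

Let span_X v : fspan (range Y) v -> X v.
Proof.
move=> Yv; apply: subset_closure; rewrite lin_spanE.
elim: Yv => [|a u w _ Yu _ IH]; first exact: kspan0.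
exact: kspan_cons.
Qed.

Let X_lin : X 0 /\ forall (a : R) u v, X u -> X v -> X (a *: u + v).
Proof. by apply/linear_subspaceP; case: (closed_span_subspace (range Y)). Qed.

Let T0 : T 0 = 0.
Proof.
by apply/eqP; rewrite -normr_le0; have [+ _] := TK 0 X_lin.1; rewrite normr0 mulr0.
Qed.

Let T_sum n (d : nat -> R) (f : nat -> E) : (forall i, (i < n)%N -> X (f i)) ->
  X (\sum_(i < n) d i *: f i) /\
  T (\sum_(i < n) d i *: f i) = \sum_(i < n) d i *: T (f i).
Proof.
elim: n => [|n IH] Xf; first by rewrite !big_ord0 T0; split => //; exact: X_lin.1.
have [|XS TS] := IH; first by move=> i iN; apply: Xf; exact: ltnW.
rewrite !big_ord_recr /= addrC [in RHS]addrC; split; first by apply: X_lin.2 => //; exact: Xf.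
by rewrite -TS; apply: TL; rewrite inE//; exact: Xf.
Qed.

(** The tolerance in [approx] makes the distance from [q] to [T p] at most [(2 * K)^-1] times the
    norm of [p]. After multiplication by [K] this error is half the norm of [p] and is absorbed on
    the left, whence the constant [2 * K]. *)
Lemma linked_norm D t p q : approx D t -> linked D t p q ->
  `|p| <= c%:R * `|q| /\ `|q| <= c%:R * `|p|.
Proof.
move=> [st tT tA DY [psi Dpsi]] [d [pE qE]].
have XD i : (i < size D)%N -> X D`_i by move=> iD; apply: span_X; apply: DY; exact: mem_nth.
have [Xp TE] := T_sum (size D) d (nth 0 D) XD.
rewrite -pE in Xp TE.
have qT : `|q - T p| <= (2 * K)^-1 * `|p|.
  rewrite TE qE -sumrB; under eq_bigr do rewrite -scalerBr.
  have del0 : 0 <= (4 * b * K)^-1 by rewrite invr_ge0 !mulr_ge0// ltW.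
  have := succ_blocks_perturb b (size D) (nth 0 D) psi d (fun i => t`_i - T D`_i)
    _ bP (ltW b0) del0 Dpsi tT.
  move/le_trans; apply; rewrite -pE le_eqVlt; apply/orP; left; apply/eqP; field.
  by rewrite !gt_eqF.
have [Tp1 Tp2] := TK p Xp.
have iK : (2 * K)^-1 <= 2^-1 by rewrite lef_pV2 ?posrE ?mulr_gt0// ler_peMr.
have p0 := normr_ge0 p.
have q1 : `|q| <= 2 * K * `|p|.
  rewrite -(subrK (T p) q); apply: le_trans (ler_normD _ _) _.
  apply: le_trans (lerD qT Tp1) _; rewrite -mulrDl ler_wpM2r//.
  by move: iK K1; lra.
have q2 : `|p| <= 2 * K * `|q|.
  have h : `|T p| <= (2 * K)^-1 * `|p| + `|q|.
    by rewrite -(subrK q (T p)); apply: le_trans (ler_normD _ _) _; rewrite distrC lerD2r.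
  have := le_trans Tp2 (ler_wpM2l (ltW K0) h).
  rewrite mulrDr mulrA (_ : K * (2 * K)^-1 = 2^-1); last by field; rewrite gt_eqF.
  by rewrite -mulrA mulr_natl; lra.
by split; [apply: le_trans q2 _|apply: le_trans q1 _]; rewrite ler_wpM2r.
Qed.

(** Images under [T] lie in the closed span of the allowed blocks, where their [F]-span is dense.
    The tolerance depends on the position in the whole list, hence the shift by [size D]. *)
Lemma approx_extend D t vs : approx D t -> (forall v, v \in vs -> fspan (range Y) v) ->
  blist (D ++ vs) -> exists t', approx (D ++ vs) (t ++ t').
Proof.
move=> [st tT tA DY _] vsY Dvs.
have /choice[g gP] (i : nat) : exists u, (i < size vs)%N ->
    fspan [set x n | n in allowed] u /\
    `|u - T vs`_i| <= (4 * b * K)^-1 / 2 ^+ (size D + i).+1.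
  case: (ltnP i (size vs)) => [iv|_]; last by exists 0.
  have e0 : 0 < (4 * b * K)^-1 / 2 ^+ (size D + i).+1 / 2.
    by rewrite !divr_gt0// ?invr_gt0 ?mulr_gt0// exprn_gt0.
  have := TA vs`_i (span_X _ (vsY _ (mem_nth 0 iv))).
  rewrite /closed_span lin_spanE => /closureP/(_ _ e0)[w wA Tw].
  have [u uA wu] := span_dense _ _ _ e0 wA.
  exists u => _; split => //; rewrite distrC -(subrK w (T _)) -addrA.
  apply: le_trans (ler_normD _ _) _; rewrite [leRHS]splitr.
  by apply: lerD; exact: ltW.
exists (mkseq g (size vs)); split => //.
- by rewrite !size_cat st size_mkseq.
- move=> i; rewrite size_cat => iDv; rewrite !nth_cat st.
  case: ltnP => iD; first exact: tT.
  have iv : (i - size D < size vs)%N by rewrite ltn_subLR.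
  by rewrite nth_mkseq//; have [_] := gP _ iv; rewrite subnKC.
- move=> v; rewrite mem_cat => /orP[/tA//|/mapP[i + ->]].
  by rewrite mem_iota => iv; case: (gP i iv).
- by move=> v; rewrite mem_cat => /orP[/DY|/vsY].
Qed.

Lemma linked_extend D t vs t' p q : size t = size D -> linked D t p q ->
  linked (D ++ vs) (t ++ t') p q.
Proof.
move=> st [d [-> ->]]; exists (fun i => if (i < size D)%N then d i else 0).
have key (s s' : seq E) : size s = size D ->
    \sum_(i < size D) d i *: s`_i =
    \sum_(i < size (D ++ vs)) (if (i < size D)%N then d i else 0) *: (s ++ s')`_i.
  move=> ss; rewrite size_cat big_split_ord /= [X in _ = _ + X]big1 ?addr0.
    by apply: eq_bigr => i _; rewrite nth_cat ss ltn_ord.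
  by move=> i _; rewrite ltnNge leq_addr scale0r.
by rewrite -!key.
Qed.

Let linked0 D t : linked D t 0 0.
Proof.
by exists (fun=> 0); split; rewrite big1// => i _; rewrite scale0r.
Qed.

Lemma infinite_set_ge M : exists2 i, A i & (M <= i)%N.
Proof.
apply: contrapT => H; apply: Ainf; apply: (sub_finite_set _ (finite_II M)) => i Ai /=.
by rewrite ltnNge; apply/negP => Mi; apply: H; exists i.
Qed.

(* The opponent copies [T] on the drawn vectors and ends each gap at an interval
   of [A] with an index exceeding the codes of all the data used so far, so that
   the strategy cannot ask for vectors beyond that interval. *)
Lemma play_absurd s D y G u : wins c%:R x s D y G u -> forall t al l0 h,
  approx D t -> size y = size u -> (forall i, linked D t y`_i u`_i) ->
  A al -> (l0 <= al)%N -> all (fun p : nat * nat => (p.1 <= al)%N) h ->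
  (forall n, (n < left_pt Y al)%N -> allowed n -> fspan [set` G] (x n)) ->
  (forall h2, response dec x Y h2 s D G =
     reply Y ([seq (left_pt Y p.1, p.2) | p <- h] ++ h2) c (phi (left_pt Y l0))) ->
  (response dec x Y [::] s D G <= right_pt Y al)%N -> False.
Proof.
elim: s D y G u => [|Q next IH|w n next IH] D y G u /=.
- move=> bad t al l0 h Dt _ yu _ _ _ _ _ _; apply: bad => a.
  apply: linked_norm Dt _; apply: span_norm_comb => //.
  move=> r p q p' q' [d [-> ->]] [d' [-> ->]].
  exists (fun i => r * d i + d' i); rewrite !scaler_sumr -!big_split /=.
  by split; apply: eq_bigr => i _; rewrite scalerA scalerDl.
- move=> [drw nextP] t al l0 h Dt syu yu Aal l0al hal GP resp bnd.
  have [[vsY Dvs Qvs] _] := drawnP _ _ _ _ Yx drw.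
  have vsY' v : v \in drawn D Q Y -> fspan (range Y) v.
    move=> /vsY; apply: (kspan_mono Fr) => g /= /mapP[i _ ->].
    by exists i.
  have [t' Dt'] := approx_extend _ _ _ Dt vsY' Dvs.
  apply: (IH _ _ _ _ _ (nextP _ Qvs) (t ++ t') al l0 h) => // i.
  by apply: linked_extend => //; case: Dt.
- move=> [Dw nextP] t al l0 h Dt syu yu Aal l0al hal GP resp bnd.
  have [d dF wE] := (kspan_seqP Fr _ _).1 Dw.
  (* The answer repeats on the approximants the combination that was picked. *)
  pose v := \sum_(i < size D) d i *: t`_i.
  have vA : fspan [set x n | n in allowed] v.
    have [st _ tA _ _] := Dt.
    apply: kspan_sum => i _; apply: (kspanZ Fr) => //; apply: tA.
    by rewrite mem_nth// st.
  have [M vM] : exists M, fspan [set x n | n in [set n | allowed n /\ (n < M)%N]] v.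
    elim: vA => [|a _ g Fa [m mA <-] _ [M gM]]; first by exists 0%N; exact: kspan0.
    exists (maxn M m.+1); apply: kspan_cons => //.
      by exists m => //; split => //; rewrite leq_max leqnn orbT.
    apply: (kspan_mono Fr) gM => _ [i [iA iM] <-]; exists i => //; split => //.
    by rewrite leq_max iM.
  have vV : VF v.
    by apply: VF_span vM => _ [i _ <-]; exact: bseq_VF.
  have [k kv] := decP v vV.
  (* The code of the bound that the strategy will set after this very answer. *)
  pose q := pickle ((c, Some (l0, h, k)) : nat * option (nat * seq (nat * nat) * nat)).
  (* [M] brings [v] into the gap ending at interval [be], [q] makes that interval outlast the next
     bound, and [al.+1] moves forward. *)
  have [be Abe] := infinite_set_ge (maxn M (maxn q al.+1)).
  rewrite !geq_max => /andP[Mbe /andP[qbe albe]].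
  pose G' := [seq x i | i <- index_iota n (left_pt Y be)].
  (* An allowed [m] lies before interval [al], where [GP] applies, or after it. In the latter case
     it exceeds the bound [n], which is at most the right end of [al], so that [x m] is in [G']. *)
  have GG' m : (m < left_pt Y be)%N -> allowed m -> fspan [set` G ++ G'] (x m).
    move=> mbe mA; case: (ltnP m (left_pt Y al)) => mal.
      by apply: (kspan_subseq G) (GP m mal mA) => g gG; rewrite mem_cat gG.
    apply: (kspan_incl Fr); rewrite /= mem_cat; apply/orP; right.
    apply/mapP; exists m => //; rewrite mem_index_iota mbe andbT.
    apply: leq_trans bnd _; rewrite leqNgt; apply/negP => mr.
    by apply: mA; exists al => //=; rewrite mal ltnW.
  have Gv : fspan [set` G ++ G'] v.
    apply: (kspan_trans Fr) vM => _ [m [mA mM] <-]; apply: GG' => //.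
    by apply: leq_trans mM _; apply: leq_trans Mbe _; exact: left_pt_ge.
  have mapE (r : seq (nat * nat)) : all (fun p => (p.1 <= al)%N) r ->
      [seq (nth 0%N (starts Y be) p.1, p.2) | p <- r] = [seq (left_pt Y p.1, p.2) | p <- r].
    move=> /allP ral; apply/eq_in_map => p /ral pal.
    by rewrite nth_starts// (leq_trans pal)// ltnW.
  have respS h2 : response dec x Y h2 (next G' v) D (G ++ G') =
      reply Y ([seq (left_pt Y p.1, p.2) | p <- rcons h (be, k)] ++ h2) c
        (phi (left_pt Y l0)).
    have := resp ((left_pt Y be, k) :: h2); rewrite /= -/G' kv.
    by rewrite asboolT// map_rcons cat_rcons.
  apply: (IH G' v _ _ _ _ (nextP G' v (legal_reply x n _ xb) Gv) t be l0 (rcons h (be, k))) => //.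
  - by rewrite !size_rcons syu.
  - move=> i; rewrite !nth_rcons syu; case: ltnP => // _; case: eqP => // _.
    by exists d.
  - by rewrite (leq_trans l0al)// ltnW.
  - rewrite all_rcons leqnn /=; apply: sub_all hal => p pal.
    by rewrite (leq_trans pal)// ltnW.
  - rewrite respS cats0; apply: leq_trans (code_value_le Y be q qbe).
    rewrite /code_value /q pickleK mapE// (nth_starts Y be be)//.
    by rewrite (nth_starts Y l0 be (leq_trans l0al (ltnW albe))) map_rcons.
Qed.

Lemma no_embedding : False.
Proof.
pose q := pickle ((c, None) : nat * option (nat * seq (nat * nat) * nat)).
have [al Aal qal] := infinite_set_ge q.
(* The starting space then contains all blocks of [x] that precede interval [al]. *)
pose N := phi (left_pt Y al).
apply: (play_absurd _ _ _ _ _ (sigmaP c N) [::] al al [::]) => //.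
- split => //; exists id; split => //.
- by move=> i; rewrite !nth_nil.
- move=> n nal _; have [phi_incr /(_ n)[_ xn]] := xphi.
  apply/kspan_mapP; exists (bcoef (x n)); first by case: xn.
  rewrite -[LHS](bproj_id N)// => i Ni; have [_] := xn; apply.
  rewrite negb_and -!leqNgt; apply/orP; right; apply: leq_trans Ni.
  exact: incr_homo.
- apply: leq_trans (code_value_le Y al q qal).
  by rewrite /code_value /q pickleK nth_starts.
Qed.

End Play.
End Intervals.

Lemma tight_of_acceptance (x : nat -> E) : bseq x ->
  (forall c N, acc c%:R x [::] [::] [seq e i | i <- iota 0 N] [::]) ->
  continuously_tight F x.
Proof.
move=> xb accx; have [phi xphi] := xb.
have [dec decP] := VF_code.
have /choice[sg sgP] (p : nat * nat) : exists s,
    wins p.1%:R x s [::] [::] [seq e i | i <- iota 0 p.2] [::].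
  exact: acc_wins.
pose sigma c N := sg (c, N).
have sigmaP c N : wins c%:R x (sigma c N) [::] [::] [seq e i | i <- iota 0 N] [::].
  exact: (sgP (c, N)).
have [b b1 bP] := bproj_bounded.
pose g Y := endpoints dec x phi sigma Y.
have g_incr Y n : (g Y n < g Y n.+1)%N by exact: endpoints_incr.
have bbx (Y : bb F x) : sub (val Y) x.
  by apply: block_sequence_sub => //; have := valP Y; rewrite inE.
pose f (Y : bb F x) : infinite_subsets :=
  exist _ (range_set (g (val Y))) (mem_set (range_set_infinite _ (g_incr (val Y)))).
have fE (Y : bb F x) j : interval_of (val (f Y)) j =
    [set m | (left_pt dec x phi sigma (val Y) j <= m <= right_pt dec x phi sigma (val Y) j)%N].
  rewrite /interval_of /= !nth_element_range//.
  by rewrite /g /endpoints /= odd_double /= uphalf_double doubleK.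
exists f.
  apply: locally_determined_continuous => Y n.
  have /choice[m mP] (k : nat) : exists M,
      forall Y', (forall i, (i < M)%N -> Y' i = val Y i) ->
      g Y' k = g (val Y) k.
    exact: (endpoints_determined dec x phi sigma xphi sigmaP (val Y) k (bbx Y)).
  (* Endpoint number [k] is at least [k], so whether [n] is an endpoint is decided by the endpoints
     of number at most [n]. *)
  exists (\max_(k < n.+1) m k) => Y' YY.
  have gE k : (k <= n)%N -> g (val Y') k = g (val Y) k.
    move=> kn; apply: mP => i im; apply: YY; apply: leq_trans im _.
    exact: (leq_bigmax (Ordinal (kn : (k < n.+1)%N))).
  apply: asbool_equiv_eq; split=> -[k gk]; exists k; rewrite -gk ?gE// -?gE// -gk;
    exact: incr_ge.
move=> Y [A Ainf [Z [Zc ZS [T [S [TL [TZ Tinj Tsurj] TS Tc Sc]]]]]].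
pose X := closed_span (range (val Y : nat -> E)).
have XL : linear_subspace X by case: (closed_span_subspace (range (val Y : nat -> E))).
have SL : linear_on Z S.
  move=> a u v; rewrite !inE => /Tsurj[u' Xu <-] /Tsurj[v' Xv <-].
  have Xuv : X (a *: u' + v') by have /linear_subspaceP[_] := XL; exact.
  by rewrite -TL ?inE// !TS ?inE.
have [K1 K10 K1P] := bounded_on _ _ XL TL Tc.
have [K2 K20 K2P] := bounded_on _ _ Zc.1 SL Sc.
pose K := 1 + K1 + K2.
have cK : 2 * K <= (Num.truncn (2 * K)).+1%:R by apply: ltW; exact: truncnS_gt.
apply: (no_embedding dec x phi sigma decP xphi sigmaP (val Y) A T K b _ (bbx Y) Ainf _ b1 cK bP TL).
- by rewrite /K -addrA lerDl addr_ge0// ltW.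
- move=> v Xv; split.
    by apply: le_trans (K1P v Xv) _; rewrite ler_wpM2r// /K addrAC lerDr addr_ge0// ltW.
  rewrite -{1}(TS v) ?inE//; apply: le_trans (K2P _ (TZ v Xv)) _.
  by rewrite ler_wpM2r// /K lerDr addr_ge0// ltW.
- move=> v Xv; have := ZS _ (TZ v Xv).
  by under [X in ~` X]eq_bigcupr do rewrite fE.
Qed.

Lemma minimal_or_tight :
  (exists2 x : nat -> E, block_sequence F e x &
     minimal_space (closed_span (range x))) \/
  (exists2 x : nat -> E, block_sequence F e x & continuously_tight F x).
Proof.
(* [k] codes a constant and the size of a starting space. If each such acceptance can be reached
   below every block sequence, fusion gets them all at once; otherwise one pair is rejected
   throughout some [x0]. *)
pose P k x := if unpickle k is Some p then
  acc (p : nat * nat).1%:R x [::] [::] [seq e i | i <- iota 0 p.2] [::] else True.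
have [dense|ndense] := pselect (forall k x, sub x e -> exists2 z, sub z x & P k z).
  right; have [|x [xb _] xP] := fusion P e bseq_basis _ dense.
    move=> k x z; rewrite /P; case: unpickle => // p px zx.
    exact: acc_almost_sub px.
  exists x; first exact: bseq_block_sequence.
  apply: tight_of_acceptance => // c N.
  by have := xP (pickle (c, N)); rewrite /P pickleK.
left.
have [c [N [x0 [x0b rej]]]] : exists (c N : nat) x0, bseq x0 /\ forall z, sub z x0 ->
    ~ acc c%:R z [::] [::] [seq e i | i <- iota 0 N] [::].
  apply: contrapT => H; apply: ndense => k x xe; rewrite /P.
  have [xb _] := xe.
  case: unpickle => [[c N]|]; last by exists x => //; exact: sub_refl.
  apply: contrapT => H'; apply: H; exists c, N, x; split => // z zx accz.
  by apply: H'; exists z.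
(* Read contrapositively: rejection for [c] from [e_0 .. e_(N-1)] gives rejection for [c * K] from
   the empty position. *)
have [K K0 KP] := acc_initial N.
have [||l lb lmin] := minimal_of_rejection (c%:R * K) x0 _ x0b.
- exact: mulr_ge0.
- by move=> z zx accz; apply: (rej z zx); apply: KP => //; case: zx.
by exists l => //; exact: bseq_block_sequence.
Qed.

End Dichotomy.

Theorem theorem3p13 (R : realType) (E : completeNormedModType R)
    (F : {pred R}) (e : nat -> E) :
  schauder_basis e -> normalised e -> block_field F e ->
  (exists2 x : nat -> E, block_sequence F e x &
     minimal_space (closed_span (range x))) \/
  (exists2 x : nat -> E, block_sequence F e x & continuously_tight F x).
Proof. by move=> eb en ef; exact: minimal_or_tight. Qed.
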